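(* Let $l\in\{1,2,3\}$ and $\varepsilon>0$. Consider a homogeneous $l$-D SCS with BS density $\lambda_0$, power-law path-loss model $\frac1{R^\varepsilon}$, and random transmission powers and fading factors that have an arbitrary joint distribution (that of $(K,\Psi)$) and are i.i.d. across all the BSs. If $\mathbb{E}\left[(K\Psi)^{\frac l\varepsilon}\right]<\infty$, then this SCS is equivalent to another homogeneous $l$-D SCS with BS density $\bar\lambda=\lambda_0\,\mathbb{E}\left[(K\Psi)^{\frac{l}{\varepsilon}}\right]$, the same path-loss model $\frac1{R^\varepsilon}$, and unity transmission power and unity fading factor at each BS.
   Context: A homogeneous $l$-D SCS (shotgun cellular system) with BS density $\lambda_0>0$ has base stations (BSs) at the points of a homogeneous Poisson point process on $\mathbb{R}^l$ of intensity $\lambda_0$. The mobile station (MS) is at the origin. With path-loss model $1/R^\varepsilon$, a BS at distance $R_j$ from the origin is received with power $K_j\Psi_j/R_j^\varepsilon$, where the pairs $(K_j,\Psi_j)$ of nonnegative random variables (transmission power, fading factor) are i.i.d. copies of $(K,\Psi)$ independent of the BS locations. Two SCSs are equivalent if the joint distribution of the powers received at the MS from all the BSs is the same in both systems (i.e. the random collections, counted with multiplicity, of nonzero received powers have the same law). *)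

(* Defs.v *)
From HB Require Import structures.
From mathcomp Require Import all_boot all_order all_algebra.
From mathcomp Require Import all_classical all_reals all_analysis.
From mathcomp Require Import measurable_realfun.

Set Implicit Arguments.
Unset Strict Implicit.
Unset Printing Implicit Defensive.

Import Order.TTheory GRing.Theory Num.Theory.
Import numFieldNormedType.Exports.

Local Open Scope classical_set_scope.
Local Open Scope ring_scope.
Local Open Scope ereal_scope.

Definition events_of (T : Type) d' (T' : measurableType d') (f : T -> T') :
  set (set T) := preimage_set_system setT f measurable.

Definition mutually_independent d (T : measurableType d) (R : realType)
    (P : probability T R) (I : eqType) (F : I -> set (set T)) : Prop :=
  forall (s : seq I) (E : I -> set T), uniq s ->
    (forall i, i \in s -> F i (E i)) ->
    P (\big[setI/setT]_(i <- s) E i) = \prod_(i <- s) P (E i).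

(* Points of R^l are l-tuples, with the Borel (product) sigma-algebra that the
   library puts on them.  The l-dimensional Lebesgue measure is the iterated
   product of the one-dimensional one: the successor case is what the library
   product measure unfolds to. *)
Fixpoint volume (R : realType) (l : nat) : set (l.-tuple R) -> \bar R :=
  match l return set (l.-tuple R) -> \bar R with
  | 0%N => fun A => (\1_A [tuple])%:E
  | m.+1 => fun A =>
      \int[lebesgue_measure]_x volume [set t : m.-tuple R | A (cons_tuple x t)]
  end.

Definition euclidean_norm (R : realType) (l : nat) (x : l.-tuple R) : R :=
  Num.sqrt (\sum_(i < l) (tnth x i) ^+ 2)%R.

(* The base stations carry labels j : nat.  Label j is in use at the outcome w
   when [present j w] holds, so that a random configuration may have finitely
   or infinitely many base stations; the other data of an unused label are
   irrelevant. *)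
Record scs (l : nat) (R : realType) (T : Type) := SCS {
  present : nat -> set T ;
  location : nat -> T -> l.-tuple R ;
  tx_power : nat -> T -> R ;
  fading : nat -> T -> R }.

Section scs_definitions.
Context (l : nat) (R : realType) d (T : measurableType d).
Implicit Types (P : probability T R) (S : scs l R T).

Definition num_bs S (A : set (l.-tuple R)) (w : T) : \bar R :=
  counting [set j | present S j w /\ A (location S j w)].

(* In [poisson_prob r k U] the argument [k] is a dummy; for [r = 0] the law is
   the Dirac mass at 0. *)
Definition homogeneous_poisson P S (lambda : R) : Prop :=
  (forall A, measurable A -> volume A < +oo -> forall k : nat,
     P [set w | num_bs S A w = k%:R%:E] =
     poisson_prob (lambda * fine (volume A))%R 0 [set k]) /\
  (forall A : nat -> set (l.-tuple R),
     (forall i, measurable (A i)) -> (forall i, volume (A i) < +oo) ->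
     trivIset setT A ->
     mutually_independent P
       (fun i => events_of (num_bs S (A i)))).

Definition mark S (j : nat) (w : T) : R * R := (tx_power S j w, fading S j w).

Definition location_events S : set (set T) :=
  <<s \bigcup_j ([set present S j] `|`
                 events_of (location S j)) >>.

Definition mark_events S (j : nat) : set (set T) :=
  events_of (mark S j).

(* [S] is a homogeneous SCS of density [lambda] whose marks are independent
   copies of [(K, Psi)], jointly independent of the base station locations. *)
Definition homogeneous_scs P S (lambda : R) d0 (T0 : measurableType d0)
    (P0 : probability T0 R) (K Psi : {RV P0 >-> R}) : Prop :=
  [/\ (forall j, [/\ measurable (present S j),
          measurable_fun setT (location S j),
          measurable_fun setT (tx_power S j) &
          measurable_fun setT (fading S j)]),
      homogeneous_poisson P S lambda,
      (forall j (C : set (R * R)), measurable C ->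
          P (mark S j @^-1` C) = P0 [set w | C (K w, Psi w)]) &
      mutually_independent P
        (fun i : option nat =>
           if i is Some j then mark_events S j else location_events S) ].

(* A base station at distance 0, which almost surely does not exist, gets
   received power 0 by the conventions for [powR] and inversion at 0. *)
Definition received_power S (eps : R) (j : nat) (w : T) : R :=
  (tx_power S j w * fading S j w / euclidean_norm (location S j w) `^ eps)%R.

(* The random collection of nonzero received powers, as the counting measure
   giving, for each B, the number of base stations with received power in B. *)
Definition received S (eps : R) (w : T) : set R -> \bar R := fun B =>
  counting [set j | [/\ present S j w, received_power S eps j w != 0%R &
                        B (received_power S eps j w)]].

End scs_definitions.

(* The sigma-algebra on counting measures generated by the evaluations at the
   Borel sets. *)
Definition evaluation_events (R : realType) : set (set (set R -> \bar R)) :=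
  <<s \bigcup_(B in measurable)
        events_of (fun m : set R -> \bar R => m B) >>.

Definition scs_equivalent (l : nat) (R : realType) (eps : R)
    d (T : measurableType d) (P : probability T R) (S : scs l R T)
    d' (T' : measurableType d') (P' : probability T' R) (S' : scs l R T') : Prop :=
  forall E, evaluation_events E ->
    P (received S eps @^-1` E) = P' (received S' eps @^-1` E).

(* Main.v *)
(**
Let r_j = K_j Psi_j / |X_j|^eps be the received powers.  For a test function
g : R -> [delta, 1] with g 0 = 1, independence lets one integrate out the marks
in E prod_j g(r_j) one label at a time, which replaces g(r_j) by
G(X_j) = E g(K Psi / |X_j|^eps).  The Laplace functional of the Poisson process
then gives
  E prod_j g(r_j) = exp (- lambda int (1 - G(x)) dx),
and Fubini with the substitution x = (K Psi)^(1/eps) y turns the exponent into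
  lambda E[(K Psi)^(l/eps)] int (1 - g(|y|^-eps)) dy.
Hence the functional depends on (lambda, K, Psi) only through
lambda E[(K Psi)^(l/eps)].  With g = prod_i t_i^(1_(B_i \ 0)) it is the joint
probability generating function of the counts of received powers in the B_i,
which determines their joint law, and cylinders generate the events.
A unit-mark system of the required density is the given one with its locations
rescaled (or without base stations if that density is 0).
*)
From HB Require Import structures.
Require Import Defs.
From mathcomp Require Import all_boot all_order all_algebra.
From mathcomp Require Import all_classical all_reals all_analysis.
From mathcomp Require Import measurable_realfun.
From mathcomp Require Import ring.
Import Order.TTheory GRing.Theory Num.Theory.
Import numFieldNormedType.Exports.
Local Open Scope classical_set_scope.
Local Open Scope ring_scope.

Set Implicit Arguments.
Unset Strict Implicit.
Unset Printing Implicit Defensive.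

(** * Lebesgue measure on tuples *)

(** Received powers may accumulate at 0, so a Borel set can contain infinitely many of them. Counts
    therefore take the value +oo, whose power is 0 for t < 1, and the exponent of the functional may
    be +oo, with exponential 0. Generating functions with t < 1 do not see the event of an infinite
    count; its weight is recovered from the total mass.

    The labelling is arbitrary: presence and location of one label may depend on those of all
    others. What is independent of the marks is the sigma-algebra of all presences and locations
    together. This is why the marks are removed label by label, and why the Poisson law enters only
    through counts in disjoint sets of finite volume.

    The lower bound [delta] keeps all factors positive: a factor is a parameter t of a generating
    function, and those are expanded only for t strictly between 0 and 1. *)

Section pushm.
Local Open Scope ereal_scope.
Context d1 d2 (T1 : measurableType d1) (T2 : measurableType d2) (R : realType).
Variable m : {measure set T1 -> \bar R}.

(* Unlike [pushforward], it records the measurability proof, which lets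
   unification find the measure structure. *)
Definition pushm (f : T1 -> T2) of measurable_fun setT f :
  set T2 -> \bar R := pushforward m f.

Variables (f : T1 -> T2) (mf : measurable_fun setT f).

Let pushm0 : pushm mf set0 = 0.
Proof. by rewrite /pushm /pushforward preimage_set0 measure0. Qed.

Let pushm_ge0 A : 0 <= pushm mf A.
Proof. exact: measure_ge0. Qed.

Let pushm_sigma_additive : semi_sigma_additive (pushm mf).
Proof.
move=> F mF tF mUF; rewrite /pushm /pushforward preimage_bigcup.
apply: measure_semi_sigma_additive.
- by move=> n; rewrite -[X in measurable X]setTI; exact: mf.
- apply/trivIsetP => /= i j _ _ ij; rewrite -preimage_setI.
  by move/trivIsetP : tF => /(_ _ _ _ _ ij) ->//; rewrite preimage_set0.
- by rewrite -preimage_bigcup -[X in measurable X]setTI; exact: mf.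
Qed.

HB.instance Definition _ := isMeasure.Build _ _ _ (pushm mf)
  pushm0 pushm_ge0 pushm_sigma_additive.

Lemma ge0_integral_pushm (h : T2 -> \bar R) :
  measurable_fun setT h -> (forall x, 0 <= h x) ->
  \int[pushm mf]_y h y = \int[m]_x h (f x).
Proof.
by move=> mh h0; rewrite ge0_integral_pushforward// preimage_setT.
Qed.

End pushm.
Arguments pushm {d1 d2 T1 T2 R} m {f}.

Section cons_measure.
Local Open Scope ereal_scope.
Context {R : realType} (m : nat).

Definition uncons (p : R * m.-tuple R) : m.+1.-tuple R := cons_tuple p.1 p.2.

Lemma measurable_uncons : measurable_fun setT uncons.
Proof. by apply: (@measurable_cons _ _ _ R fst m snd). Qed.

Variable nu : {sigma_finite_measure set (m.-tuple R) -> \bar R}.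

Local Notation leb := (@lebesgue_measure R).

Definition cons_measure : set (m.+1.-tuple R) -> \bar R :=
  pushm (leb \x nu) measurable_uncons.

HB.instance Definition _ := Measure.on cons_measure.

Let cons_measure_sigma_finite : sigma_finite setT cons_measure.
Proof.
have /sigma_finiteP[F [FT ndF Foo]] := sigma_finiteT (@lebesgue_measure R).
have /sigma_finiteP[G [GT ndG Goo]] := sigma_finiteT nu.
(* [v] inverts [uncons], so the preimage under [v] of a rectangle has the measure of that
   rectangle. *)
pose v (t : m.+1.-tuple R) := (thead t, [tuple of behead t]).
have mv : measurable_fun setT v.
  apply: measurable_fun_pair; first exact: measurable_tnth.
  exact: measurable_behead.
exists (fun k => v @^-1` (F k `*` G k)).
  rewrite -preimage_bigcup; apply/seteqP; split => // t _ /=.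
  have : (\bigcup_k F k) (thead t) by rewrite -FT.
  have : (\bigcup_k G k) [tuple of behead t] by rewrite -GT.
  move=> -[k _ Gk] [n _ Fn]; exists (maxn n k) => //; split => /=.
  - by move: Fn; exact/subsetPset/ndF/leq_maxl.
  - by move: Gk; exact/subsetPset/ndG/leq_maxr.
move=> k; have [mF Fk] := Foo k; have [mG Gk] := Goo k.
have mFG : measurable (F k `*` G k) by exact: measurableX.
split; first by rewrite -[X in measurable X]setTI; exact: mv.
rewrite /cons_measure /pushm /pushforward -comp_preimage.
have FGk : (leb \x nu) (F k `*` G k) < +oo.
  by rewrite product_measure1E// lte_mul_pinfty// ge0_fin_numE.
suff -> : v \o uncons = id by exact: FGk.
apply/funext => -[x t]; rewrite /v /uncons /=; congr pair.
by apply/val_inj.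
Qed.
HB.instance Definition _ := @Measure_isSigmaFinite.Build _ _ _ cons_measure
  cons_measure_sigma_finite.

Lemma ge0_integral_cons_measure (f : m.+1.-tuple R -> \bar R) :
  measurable_fun setT f -> (forall x, 0 <= f x) ->
  \int[cons_measure]_x f x = \int[leb]_x \int[nu]_t f (uncons (x, t)).
Proof.
move=> mf f0.
rewrite ge0_integral_pushm// fubini_tonelli1//.
exact: measurableT_comp mf measurable_uncons.
Qed.

End cons_measure.

Fixpoint vol (R : realType) (l : nat) :
    {sigma_finite_measure set (l.-tuple R) -> \bar R} :=
  match l return {sigma_finite_measure set (l.-tuple R) -> \bar R} with
  | 0%N => \d_([tuple] : 0.-tuple R)
  | m.+1 => cons_measure (vol R m)
  end.

Lemma volE (R : realType) l (A : set (l.-tuple R)) : vol R l A = volume A.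
Proof.
elim: l A => [|l IH] A //=.
rewrite /cons_measure /pushm /pushforward /product_measure1.
apply: eq_integral => x _; rewrite -IH /=; congr (vol R l _).
by apply/seteqP; split=> t; rewrite /xsection /= inE.
Qed.

(** * Lebesgue measure under dilations *)

Section scaling.
Local Open Scope ereal_scope.
Context {R : realType}.
Implicit Types c : R.

Lemma measurable_mulrl c : measurable_fun setT ( *%R c : R -> R).
Proof. exact: measurable_funM. Qed.

(** The pushforward of Lebesgue measure under multiplication by [c], scaled by [c], gives half-open
    intervals their length; uniqueness of Lebesgue measure does the rest. *)
Lemma lebesgue_scale c (A : set R) : (0 < c)%R -> measurable A ->
  @lebesgue_measure R ( *%R c @^-1` A) = (c^-1)%:E * lebesgue_measure A.
Proof.
move=> c0 mA; pose cn := NngNum (ltW c0).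
have mm : measurable_fun setT ( *%R c : measurableTypeR R -> measurableTypeR R).
  exact: measurable_mulrl.
have := @lebesgue_measure_unique R (mscale cn (pushm (@lebesgue_measure R) mm)).
move=> /(_ _ A mA) -> /=; last first.
  move=> _ [[a b] _ <-] /=; rewrite /mscale/= /pushm /pushforward.
  have -> : ( *%R c @^-1` `]a, b]) = `](a / c)%R, (b / c)%R]%classic.
    apply/seteqP; split=> x /=; rewrite !in_itv/=;
    by rewrite ltr_pdivrMr// ler_pdivlMr// [(x * c)%R]mulrC.
  rewrite !lebesgue_measure_itv/= !lte_fin ltr_pM2r ?invr_gt0//.
  case: ifPn => ab; last by rewrite mule0.
  by rewrite -!EFinB -EFinM -mulrBl mulrCA divff ?mulr1 ?gt_eqF.
by rewrite /mscale/= muleA -EFinM mulVf ?gt_eqF// mul1e.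
Qed.

Lemma ge0_integral_lebesgue_scale c (f : R -> \bar R) : (0 < c)%R ->
  measurable_fun setT f -> (forall x, 0 <= f x) ->
  \int[@lebesgue_measure R]_x f (c * x)%R =
  (c^-1)%:E * \int[lebesgue_measure]_x f x.
Proof.
move=> c0 mf f0.
have ci0 : (0 <= c^-1)%R by rewrite invr_ge0 ltW.
have mm : measurable_fun setT ( *%R c : measurableTypeR R -> measurableTypeR R).
  exact: measurable_mulrl.
rewrite -(ge0_integral_pushm _ mm)//.
transitivity (\int[mscale (NngNum ci0) (@lebesgue_measure R)]_x f x).
  apply: eq_measure_integral => A mA _.
  rewrite /pushm /pushforward; exact: lebesgue_scale.
by rewrite ge0_integral_mscale.
Qed.

Definition scale_tuple c l : l.-tuple R -> l.-tuple R := map_tuple ( *%R c).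

Lemma measurable_scale_tuple c l : measurable_fun setT (@scale_tuple c l).
Proof.
apply/measurable_fun_tnthP => i.
rewrite (_ : _ \o _ = fun x => (c * tnth x i)%R); last first.
  by apply/funext => x /=; rewrite tnth_map.
by apply: measurable_funM => //; exact: measurable_tnth.
Qed.

Lemma scale_tuple_uncons c l (x : R) (t : l.-tuple R) :
  scale_tuple c (uncons (x, t)) = uncons ((c * x)%R, scale_tuple c t).
Proof. exact/val_inj. Qed.

(** Tonelli splits off one coordinate at a time, and each one-dimensional substitution contributes a
    factor [c^-1]. *)
Lemma ge0_integral_vol_scale c l (f : l.-tuple R -> \bar R) : (0 < c)%R ->
  measurable_fun setT f -> (forall x, 0 <= f x) ->
  \int[vol R l]_x f (scale_tuple c x) = (c^-1 ^+ l)%:E * \int[vol R l]_x f x.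
Proof.
move=> c0; elim: l f => [|l IH] f mf f0.
  rewrite expr0 mul1e; apply: eq_integral => x _; congr f.
  by rewrite (tuple0 x) (tuple0 (scale_tuple _ _)).
have mfu : measurable_fun setT (f \o uncons (m:=l)).
  exact: (measurableT_comp mf (@measurable_uncons R l)).
rewrite /= !ge0_integral_cons_measure//; last first.
  exact: (measurableT_comp mf (@measurable_scale_tuple c l.+1)).
under eq_integral do under eq_integral do rewrite scale_tuple_uncons.
pose h x := \int[vol R l]_t f (uncons (x, t)).
have mh : measurable_fun setT h.
  apply: (measurable_fun_fubini_tonelli_F (f \o @uncons R l)) => //.
  by move=> x; exact: f0.
transitivity (\int[lebesgue_measure]_x ((c^-1 ^+ l)%:E * h (c * x)%R)).
  apply: eq_integral => x _.
  rewrite -(IH (fun t => f (uncons ((c * x)%R, t))))//.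
  exact: (measurableT_comp mfu (pair1_measurable (c * x)%R)).
have h0 x : 0 <= h x by exact: integral_ge0.
rewrite ge0_integralZl//.
- by rewrite ge0_integral_lebesgue_scale// muleA -EFinM -exprSr.
- exact: (measurableT_comp mh (measurable_mulrl c)).
- by rewrite lee_fin exprn_ge0// invr_ge0 ltW.
Qed.

Lemma vol_scale c l (A : set (l.-tuple R)) : (0 < c)%R -> measurable A ->
  vol R l (@scale_tuple c l @^-1` A) = (c^-1 ^+ l)%:E * vol R l A.
Proof.
move=> c0 mA.
have mS : measurable (@scale_tuple c l @^-1` A).
  by rewrite -[X in measurable X]setTI; exact: measurable_scale_tuple.
transitivity (\int[vol R l]_x (\1_(@scale_tuple c l @^-1` A) x)%:E).
  by rewrite integral_indic// setIT.
rewrite (ge0_integral_vol_scale (f := fun x => (\1_A x)%:E))//; last first.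
  by apply/measurable_EFinP; exact: measurable_indic.
by rewrite integral_indic// setIT.
Qed.

Lemma measurable_euclidean_norm l : measurable_fun setT (@euclidean_norm R l).
Proof.
apply: measurableT_comp; first by apply: continuous_measurable_fun; exact: sqrt_continuous.
apply: measurable_sum => i; apply: measurable_funX.
exact: measurable_tnth.
Qed.

Lemma euclidean_norm_ge0 l (x : l.-tuple R) : (0 <= euclidean_norm x)%R.
Proof. exact: sqrtr_ge0. Qed.

Lemma euclidean_norm_scale c l (x : l.-tuple R) : (0 <= c)%R ->
  euclidean_norm (scale_tuple c x) = (c * euclidean_norm x)%R.
Proof.
move=> c0; rewrite /euclidean_norm.
under eq_bigr do rewrite tnth_map exprMn.
by rewrite -mulr_sumr sqrtrM ?sqr_ge0// sqrtr_sqr ger0_norm.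
Qed.

End scaling.

(** * Infinite products and probability generating functions *)

Section bounded_integrals.
Local Open Scope ereal_scope.
Context {R : realType} d (T : measurableType d).

Lemma measurable_fun_mem (D : set T) : measurable D ->
  measurable_fun setT (fun w => w \in D).
Proof.
move=> mD; apply: (measurable_fun_bool true); rewrite setTI.
rewrite (_ : _ @^-1` _ = D)//; apply/seteqP.
by split=> w /= => [/set_mem|Dw]; last exact/mem_set.
Qed.

Lemma measurable_counting (D : nat -> set T) : (forall j, measurable (D j)) ->
  measurable_fun setT (fun w => counting [set j | D j w] : \bar R).
Proof.
move=> mD; rewrite (_ : (fun w => _) =
    (fun w => \sum_(j <oo) (\1_(D j) w)%:E)); last first.
  apply/funext => w; rewrite counting_dirac; apply: eq_eseriesr => j _.
  rewrite diracE indicE; suff -> : (j \in [set j | D j w]) = (w \in D j) by [].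
  by apply/idP/idP => /set_mem h; apply/mem_set.
apply: ge0_emeasurable_sum => // j _; apply/measurable_EFinP.
exact: measurable_indic.
Qed.

Lemma bounded_cvg_integral (P : probability T R) (f : nat -> T -> R) (g : T -> R) :
  (forall n, measurable_fun setT (f n)) -> measurable_fun setT g ->
  (forall n w, (0 <= f n w <= 1)%R) ->
  (forall w, f n w @[n --> \oo] --> g w) ->
  \int[P]_w (f n w)%:E @[n --> \oo] --> \int[P]_w (g w)%:E.
Proof.
move=> mf mg f01 fg.
have [] := @dominated_convergence _ _ _ P _ measurableT
  (fun n w => (f n w)%:E) (fun w => (g w)%:E) (EFin \o cst 1%R).
- by move=> n; apply/measurable_EFinP.
- exact/measurable_EFinP.
- by apply: aeW => w _; apply/cvg_EFin; [exact: nearW|exact: fg].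
- exact: finite_measure_integrable_cst.
- apply: aeW => w n _ /=; have /andP[f0 f1] := f01 n w.
  by rewrite lee_fin ger0_norm.
by [].
Qed.

Lemma integral_itv01 (P : probability T R) (f : T -> R) :
  measurable_fun setT f -> (forall w, (0 <= f w <= 1)%R) ->
  0 <= \int[P]_w (f w)%:E <= 1.
Proof.
move=> mf f01; apply/andP; split.
  by apply: integral_ge0 => w _; rewrite lee_fin; have /andP[] := f01 w.
rewrite [leRHS](_ : _ = \int[P]_w cst 1 w); last first.
  by rewrite integral_cst// mul1e; exact/esym/probability_setT.
apply: ge0_le_integral => //.
- by move=> w _; rewrite lee_fin; have /andP[] := f01 w.
- exact/measurable_EFinP.
- by move=> w _; rewrite lee_fin; have /andP[] := f01 w.
Qed.

Lemma integral_itv01_fin_num (P : probability T R) (f : T -> R) :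
  measurable_fun setT f -> (forall w, (0 <= f w <= 1)%R) ->
  \int[P]_w (f w)%:E \is a fin_num.
Proof.
move=> mf f01; have /andP[h0 h1] := integral_itv01 P mf f01.
by rewrite ge0_fin_numE//; apply: le_lt_trans h1 (ltry 1).
Qed.

(** The limit +oo has to be covered, because the Poisson exponent is infinite as soon as [1 - G] is
    not integrable. *)
Lemma cvg_expeRN (u : nat -> \bar R) l : u n @[n --> \oo] --> l ->
  (forall n, 0 <= u n) ->
  expeR (- u n) @[n --> \oo] --> expeR (- l).
Proof.
move=> ul u0; case: l ul => [r||].
- move=> /fine_cvgP[ufin ur].
  apply/fine_cvgP; split.
    near=> n; have : u n \is a fin_num by near: n.
    by case: (u n).
  have : expR (- fine (u n)) @[n --> \oo] --> expR (- r).
    by apply: continuous_cvg; [exact: continuous_expR|exact: cvgN].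
  apply: cvg_trans; apply: near_eq_cvg; near=> n => /=.
  have : u n \is a fin_num by near: n.
  by case: (u n).
- move=> /cvgeyPge uoo; apply/fine_cvgP; split.
    apply: nearW => n; have := u0 n; by case: (u n).
  apply/cvgrPdist_le => e e0; near=> n.
  have : (- ln e)%:E <= u n by near: n; exact: uoo.
  rewrite /= sub0r normrN.
  case: (u n) => [r||]//=; last by move=> _; rewrite normr0 ltW.
  rewrite lee_fin => er; rewrite ger0_norm ?expR_ge0//.
  by rewrite -[leRHS]lnK ?posrE// ler_expR lerNl.
- move=> ul; have : 0 <= -oo :> \bar R.
    rewrite -(cvg_lim _ ul)//; apply: lime_ge; first by apply/cvg_ex; exists -oo.
    exact: nearW.
  by [].
Unshelve. all: by end_near. Qed.

End bounded_integrals.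

Section nneseries_indic.
Local Open Scope ereal_scope.
Context {R : realType}.
Implicit Types f : nat -> \bar R.

Lemma nneseries_indic_nat f (k : nat) : (forall i, 0 <= f i) ->
  \sum_(i <oo) f i * (\1_[set i%:R%:E] (k%:R%:E : \bar R))%:E = f k.
Proof.
move=> f0; rewrite (@nneseriesD1 _ _ k xpredT)//; last first.
  by move=> i _; rewrite mule_ge0// lee_fin.
rewrite indicE mem_set//= mule1 eseries0 ?adde0// => i _ ik.
rewrite indicE memNset ?mule0//= => -[] /eqP; rewrite eqr_nat => /eqP ki.
by move: ik; rewrite ki eqxx.
Qed.

Lemma nneseries_indic_pinfty f :
  \sum_(i <oo) f i * (\1_[set i%:R%:E] (+oo%E : \bar R))%:E = 0.
Proof. by rewrite eseries0// => i _ _; rewrite indicE memNset ?mule0. Qed.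

End nneseries_indic.

Section iprod.
Context {R : realType}.
Implicit Types (u v : nat -> R) (t : R).

(** Absent labels will contribute the factor 1. With all factors in [0,1] the partial products
    decrease, so the limit exists without any summability and may be 0. *)
Definition iprod u : R := limn (fun n => \prod_(i < n) u i).

Section le1.
Variables (u : nat -> R) (u01 : forall j, 0 <= u j <= 1).

Lemma prod_itv01 n : 0 <= \prod_(i < n) u i <= 1.
Proof.
rewrite prodr_ge0 => [|i _]; last by have /andP[] := u01 i.
by rewrite prodr_ile1.
Qed.

Lemma nonincreasing_prod : nonincreasing_seq (fun n => \prod_(i < n) u i).
Proof.
apply/nonincreasing_seqP => n; rewrite big_ord_recr/= ler_piMr//.
  by have /andP[] := prod_itv01 n.
by have /andP[] := u01 n.
Qed.

Lemma iprod_is_cvg : cvgn (fun n => \prod_(i < n) u i).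
Proof.
apply: nonincreasing_is_cvgn; first exact: nonincreasing_prod.
by exists 0 => _ [n _ <-]; have /andP[] := prod_itv01 n.
Qed.

Lemma iprod_ge0 : 0 <= iprod u.
Proof.
apply: limr_ge; first exact: iprod_is_cvg.
by apply: nearW => n; have /andP[] := prod_itv01 n.
Qed.

Lemma iprod_le_prod n : iprod u <= \prod_(i < n) u i.
Proof. exact: (nonincreasing_cvgn_ge nonincreasing_prod iprod_is_cvg). Qed.

Lemma iprod_le1 : iprod u <= 1.
Proof. by apply: le_trans (iprod_le_prod 0) _; rewrite big_ord0. Qed.

End le1.

Lemma iprod_itv01 u : (forall j, 0 <= u j <= 1) -> 0 <= iprod u <= 1.
Proof. by move=> u01; rewrite iprod_ge0// iprod_le1. Qed.

Lemma iprod_le u v : (forall j, 0 <= u j <= 1) -> (forall j, 0 <= v j <= 1) ->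
  (forall j, u j <= v j) -> iprod u <= iprod v.
Proof.
move=> u01 v01 uv; apply: ler_lim; [exact: iprod_is_cvg|exact: iprod_is_cvg|].
apply: nearW => n; apply: ler_prod => i _; rewrite uv andbT.
by have /andP[] := u01 i.
Qed.

Lemma iprod1 : iprod (fun=> 1) = 1.
Proof.
rewrite /iprod; under eq_fun do rewrite big1//.
by apply/cvg_lim => //; exact: cvg_cst.
Qed.

Lemma iprod_prod (I : Type) (s : seq I) (u : I -> nat -> R) :
  (forall i j, 0 <= u i j <= 1) ->
  iprod (fun j => \prod_(i <- s) u i j) = \prod_(i <- s) iprod (u i).
Proof.
move=> u01; elim: s => [|a s IH].
  by rewrite big_nil -[RHS]iprod1; congr iprod; apply/funext => j; rewrite big_nil.
rewrite big_cons -IH /iprod.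
under eq_fun do (under eq_bigr do rewrite big_cons; rewrite big_split/=).
apply/cvg_lim => //; apply: cvgM; first exact: iprod_is_cvg.
apply: (@iprod_is_cvg (fun j => \prod_(k <- s) u k j)) => j.
apply/andP; split; first by apply: prodr_ge0 => i _; have /andP[] := u01 i j.
elim: s {IH} => [|b s IH]; first by rewrite big_nil.
rewrite big_cons mulr_ile1//; try by have /andP[] := u01 b j.
by rewrite prodr_ge0 => [//|i _]; have /andP[] := u01 i j.
Qed.

(** Truncation at a fixed [N] bounds [iprod (u m)] above by a finite product, which converges. From
    below nothing comparable holds in general, since a small factor could escape to infinity with
    [m]; the assumption [v j <= u m j] excludes this. *)
Lemma cvg_iprod (u : nat -> nat -> R) v : (forall m j, 0 <= u m j <= 1) ->
  (forall m j, v j <= u m j) -> (forall j, 0 <= v j) ->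
  (forall j, u m j @[m --> \oo] --> v j) ->
  iprod (u m) @[m --> \oo] --> iprod v.
Proof.
move=> u01 vu v0 uv.
have v01 j : 0 <= v j <= 1.
  by rewrite v0/= (le_trans (vu 0%N j))//; have /andP[] := u01 0%N j.
apply/cvgrPdist_le => e e0.
have /cvgrPdist_lt /(_ _ e0) [N _ /(_ N (leqnn _)) hN] := iprod_is_cvg v01.
have uvN : \prod_(j < N) u m j @[m --> \oo] --> \prod_(j < N) v j.
  elim: (N) => [|n IHn].
    rewrite big_ord0 (_ : (fun m => _) = cst 1); first exact: cvg_cst.
    by apply/funext => m; rewrite big_ord0.
  rewrite big_ord_recr (_ : (fun m => _) =
      (fun m => \prod_(j < n) u m j * u m n)).
    apply: cvgM; [exact: IHn|exact: uv].
  by apply/funext => m; rewrite big_ord_recr.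
have NE : \prod_(j < N) v j < iprod v + e.
  by move: hN; rewrite /= ltr_distlC => /andP[_].
have /cvgr_lt /(_ _ NE) h := uvN.
near=> m; rewrite distrC ger0_norm ?subr_ge0; last exact: iprod_le.
rewrite lerBlDl; apply: le_trans (iprod_le_prod (u01 m) N) (ltW _).
by near: m.
Unshelve. all: by end_near. Qed.

Lemma measurable_iprod d (T : measurableType d) (u : nat -> T -> R) :
  (forall j w, 0 <= u j w <= 1) -> (forall j, measurable_fun setT (u j)) ->
  measurable_fun setT (fun w => iprod (u^~ w)).
Proof.
move=> u01 mu; apply: (@measurable_fun_cvg _ _ _ setT
  (fun n w => \prod_(i < n) u i w)) => [n|w _].
  by apply: measurable_prod.
by apply: iprod_is_cvg.
Qed.

(* [t ^ N] for a count [N], with [t ^ +oo = 0]; the value at [-oo] is junk. *)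
Definition tpow t (N : \bar R) : R := if N is r%:E then t `^ r else 0.

Lemma counting_natP (D : set nat) :
  (exists k : nat, counting D = k%:R%:E :> \bar R) \/ counting D = +oo%E :> \bar R.
Proof.
by rewrite /counting; case: ifPn => _; [left; eexists|right].
Qed.

Lemma cvg_counting (D : set nat) :
  (((\sum_(i < n) ((i : nat) \in D))%N)%:R%:E)%E @[n --> \oo] --> (counting D : \bar R).
Proof.
rewrite counting_dirac.
rewrite (_ : (fun _ => _) = (fun n => (\sum_(0 <= i < n) \d_i D))%E).
  by apply: is_cvg_nneseries.
apply/funext => n; rewrite big_mkord natr_sum -sumEFin.
by apply: eq_bigr => i _; rewrite diracE.
Qed.

Lemma iprod_tpow (D : set nat) t : 0 <= t < 1 ->
  iprod (fun j => if j \in D then t else 1) = tpow t (counting D).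
Proof.
move=> /andP[t0 t1]; apply/cvg_lim => //.
under eq_fun.
  move=> n; rewrite (_ : \prod_(i < n) _ = t ^+ (\sum_(i < n) ((i : nat) \in D))%N).
    over.
  by rewrite expr_sum; apply: eq_bigr => i _; case: (_ \in D).
have := @cvg_counting D; case: (counting_natP D) => [[k ->]|->].
  (* Partial counts are integers: once at distance less than 1 from [k] they equal [k], so the
     powers of [t] are eventually constant. *)
  move=> /fine_cvgP[_] /= /cvgrPdist_lt /(_ 1 ltr01) h.
  rewrite powR_mulrn//; apply: cvg_near_cst; near=> n.
  have : `|k%:R - (\sum_(i < n) ((i : nat) \in D))%:R| < 1 :> R by near: n.
  set c := (\sum_(i < n) _)%N.
  rewrite ltr_distlC => /andP[h1 h2]; congr (_ ^+ _); apply/eqP.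
  rewrite eqn_leq -(ltnS c) -(ltnS k) -!(ltr_nat R) -!natr1.
  by rewrite h2 -ltrBlDr h1.
move=> /cvgeyPge h; apply/cvgrPdist_le => e e0.
have : `|t| < 1 by rewrite ger0_norm.
move=> /cvg_expr/cvgrPdist_le /(_ _ e0) [M _ hM].
near=> n; apply: hM => /=.
have : (M%:R%:E <= (\sum_(i < n) ((i : nat) \in D))%N%:R%:E :> \bar R)%E by near: n; exact: h.
by rewrite lee_fin ler_nat.
Unshelve. all: by end_near. Qed.

(** A count +oo matches no term of the series, in agreement with its power being 0. *)
Lemma tpow_series t (N : \bar R) : 0 < t < 1 ->
  (exists k : nat, N = k%:R%:E) \/ N = +oo%E ->
  ((tpow t N)%:E = \sum_(k <oo) (t ^+ k)%:E * (\1_[set k%:R%:E] N)%:E)%E.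
Proof.
move=> /andP[/ltW t0 _] [[k ->]|->]; last by rewrite nneseries_indic_pinfty.
rewrite nneseries_indic_nat /= ?powR_mulrn// => i.
by rewrite lee_fin exprn_ge0.
Qed.

End iprod.

(** * Uniqueness of the coefficients of a power series *)

Section nneseries_coefficients.
Local Open Scope ereal_scope.
Context {R : realType}.
Implicit Types (a b f : nat -> \bar R) (t : R).

(* For [t -> 0] the first coefficient that differs dominates. *)
Lemma nneseries_coeff_le a b : (forall k, 0 <= a k) -> (forall k, 0 <= b k) ->
  \sum_(k <oo) a k <= 1 -> \sum_(k <oo) b k <= 1 ->
  (forall t, (0 < t < 1)%R ->
    \sum_(k <oo) (t ^+ k)%:E * a k = \sum_(k <oo) (t ^+ k)%:E * b k) ->
  forall k, (forall i, (i < k)%N -> a i = b i) -> a k <= b k.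
Proof.
move=> a0 b0 a1 b1 ab k IH.
have fin f : (forall k, 0 <= f k) -> \sum_(k <oo) f k <= 1 ->
    forall k, f k \is a fin_num.
  move=> f0 f1 i; rewrite ge0_fin_numE//; apply: le_lt_trans (ltry 1).
  apply: le_trans f1; rewrite (@nneseriesD1 _ _ i xpredT)// leeDl//.
  exact: nneseries_ge0.
suff h t : (0 < t < 1)%R -> a k <= b k + t%:E.
  apply/lee_addgt0Pr => e e0.
  (* The cap 1/2 keeps the chosen [t] below 1. *)
  have m0 : (0 < Num.min e 2^-1)%R by rewrite lt_min e0/= invr_gt0.
  have m1 : (Num.min e 2^-1 < 1)%R.
    by rewrite gt_min; apply/orP; right; rewrite invf_lt1// ltr1n.
  apply: le_trans (h (Num.min e 2^-1)%R _) _; first by rewrite m0 m1.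
  by apply: leeD => //; rewrite lee_fin ge_min lexx.
move=> t01; have /andP[t0 t1] := t01; have := ab t t01.
have t00 := ltW t0; have t11 := ltW t1.
have tf0 f (f0 : forall k, 0 <= f k) i : 0 <= (t ^+ i)%:E * f i.
  by rewrite mule_ge0// lee_fin exprn_ge0.
rewrite (@nneseries_split _ _ 0 k); last by move=> i _; exact: tf0.
rewrite [in RHS](@nneseries_split _ _ 0 k); last by move=> i _; exact: tf0.
rewrite add0n [X in X + _]big_nat [X in _ = X + _]big_nat.
rewrite (eq_bigr (fun i => (t ^+ i)%:E * b i)); last first.
  by move=> i /andP[_ ik]; rewrite IH.
set s := \sum_(0 <= i < k | _) _.
have sfin : s \is a fin_num.
  by apply/sum_fin_numP => i _ _; rewrite fin_numM// fin.
move=> /(congr1 (fun x => x - s)); rewrite addeAC subee// add0e addeAC subee//.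
rewrite add0e => abk.
have tk : (0 < t ^+ k)%R by rewrite exprn_gt0.
rewrite -(@lee_pmul2l _ (t ^+ k)%:E)//.
apply: (@le_trans _ _ (\sum_(k <= i <oo) (t ^+ i)%:E * a i)).
  rewrite (@nneseries_split _ _ k 1) ?addn1 ?big_nat1 ?leeDl//.
    by apply: nneseries_ge0 => i _ _; exact: tf0.
  by move=> i _; exact: tf0.
rewrite abk (@nneseries_split _ _ k 1) ?addn1 ?big_nat1; last first.
  by move=> i _; exact: tf0.
rewrite muleDr//; last by rewrite ge0_adde_def// inE ?lee_fin.
rewrite leeD2l// -EFinM -exprSr -[leRHS]mule1.
(* Past index [k] every power of [t] is at most [t ^+ k.+1], and the total mass of [b] is at most 1.
   The tail thus costs at most [t ^+ k.+1], which is the error [t] after division by [t ^+ k]. *)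
apply: (@le_trans _ _ ((t ^+ k.+1)%:E * \sum_(k.+1 <= i <oo) b i)).
  rewrite -nneseriesZl//.
  rewrite eseries_cond [leRHS]eseries_cond.
  apply: lee_nneseries => i; first by move=> _ _; exact: tf0.
  move=> /= ki; apply: lee_wpmul2r => //.
  by rewrite lee_fin ler_wiXn2l.
rewrite lee_pmul2l ?lte_fin ?exprn_gt0//; apply: le_trans b1.
rewrite (@nneseries_split _ b 0 k.+1)// add0n leeDr//.
by apply: sume_ge0 => i _.
Qed.

Lemma nneseries_coeff_inj a b : (forall k, 0 <= a k) -> (forall k, 0 <= b k) ->
  \sum_(k <oo) a k <= 1 -> \sum_(k <oo) b k <= 1 ->
  (forall t, (0 < t < 1)%R ->
    \sum_(k <oo) (t ^+ k)%:E * a k = \sum_(k <oo) (t ^+ k)%:E * b k) ->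
  a =1 b.
Proof.
move=> a0 b0 a1 b1 ab; elim/ltn_ind => k IH; apply/eqP; rewrite eq_le.
rewrite (nneseries_coeff_le a0 b0)//= (nneseries_coeff_le b0 a0)//.
- by move=> t t01; rewrite ab.
- by move=> i ik; rewrite IH.
Qed.

End nneseries_coefficients.

Section pgf.
Local Open Scope ereal_scope.
Context {R : realType}.

Definition nat_valued T (N : T -> \bar R) :=
  forall w, (exists k : nat, N w = k%:R%:E) \/ N w = +oo.

Lemma tpow_itv01 (t : R) (x : \bar R) : (0 < t < 1)%R ->
  (exists k : nat, x = k%:R%:E) \/ x = +oo -> (0 <= tpow t x <= 1)%R.
Proof.
move=> /andP[t0 t1] [[k ->]|->]; last by rewrite lexx ler01.
have t0' := ltW t0; rewrite /= powR_mulrn//.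
by apply/andP; split; [exact: exprn_ge0|apply: exprn_ile1 => //; exact: ltW].
Qed.

Lemma prod_seq_itv01 (I : Type) (r : seq I) (h : I -> R) :
  (forall j, (0 <= h j <= 1)%R) -> (0 <= \prod_(j <- r) h j <= 1)%R.
Proof.
move=> h01; elim: r => [|j r /andP[IH0 IH1]]; first by rewrite big_nil ler01 lexx.
have /andP[h0 h1] := h01 j.
by rewrite big_cons mulr_ge0//= mulr_ile1.
Qed.

Lemma measurable_prod_seq d (T : measurableType d) (I : Type) (r : seq I) (h : I -> T -> R) :
  (forall j, measurable_fun setT (h j)) ->
  measurable_fun setT (fun w => \prod_(j <- r) h j w)%R.
Proof.
move=> mh; elim: r => [|j r IH].
  by under eq_fun do rewrite big_nil; exact: measurable_cst.
by under eq_fun do rewrite big_cons; exact: measurable_funM.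
Qed.

Lemma measurable_tpow_comp d (T : measurableType d) (t : R) (M : T -> \bar R) : (0 < t < 1)%R ->
  measurable_fun setT M -> nat_valued M ->
  measurable_fun setT (fun w => tpow t (M w)).
Proof.
move=> t01 mM Mnat; apply/measurable_EFinP; rewrite (_ : _ \o _ = fun w =>
   \sum_(k <oo) (t ^+ k)%:E * (\1_[set k%:R%:E] (M w))%:E); last first.
  by apply/funext => w /=; rewrite -tpow_series.
apply: ge0_emeasurable_sum => k.
  move=> w _ _; rewrite mule_ge0// lee_fin exprn_ge0//.
  by case/andP : t01 => /ltW.
move=> _; apply: measurable_funeM; apply/measurable_EFinP.
exact: (measurableT_comp (measurable_indic _) mM).
Qed.

Section expansion.
Context d (T : measurableType d) (P : probability T R).
Variables (F : T -> R) (N : T -> \bar R).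
Hypotheses (mF : measurable_fun setT F) (F01 : forall w, (0 <= F w <= 1)%R).
Hypotheses (mN : measurable_fun setT N) (Nnat : nat_valued N).

(** The coefficient of t^k in E[F t^N]. The weight [F] carries the other counts along, as powers or
    as indicators, while a single count [N] is expanded. *)
Definition coeff (k : nat) := \int[P]_w (F w * \1_[set k%:R%:E] (N w))%:E.

Let F0 w : (0 <= F w)%R. Proof. by have /andP[] := F01 w. Qed.

Let m1 (C : set (\bar R)) : measurable C ->
  measurable_fun setT (fun w => (F w * \1_C (N w))%R).
Proof.
move=> mC; apply: measurable_funM => //.
exact: (measurableT_comp (measurable_indic mC) mN).
Qed.

Lemma coeff_ge0 k : 0 <= coeff k.
Proof. by apply: integral_ge0 => w _; rewrite lee_fin mulr_ge0. Qed.

Lemma integral_nat_series (c : nat -> R) : (forall k, (0 <= c k)%R) ->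
  \int[P]_w ((F w)%:E * \sum_(k <oo) (c k)%:E * (\1_[set k%:R%:E] (N w))%:E) =
  \sum_(k <oo) (c k)%:E * coeff k.
Proof.
move=> c0.
under eq_integral.
  move=> w _; rewrite -nneseriesZl; last by move=> k _; rewrite -EFinM lee_fin mulr_ge0.
  over.
rewrite /= integral_nneseries//; last 2 first.
- move=> k; rewrite (_ : (fun w => _) =
      (fun w => (c k)%:E * (F w * \1_[set k%:R%:E] (N w))%:E)); last first.
    by apply/funext => w; rewrite muleCA -EFinM.
  by apply: (@measurable_funeM _ _ _ _ _ (c k)%:E);
    apply/measurable_EFinP; exact: m1.
- by move=> k w _; rewrite -!EFinM lee_fin !mulr_ge0.
apply: eq_eseriesr => k _; rewrite -ge0_integralZl//.
- by apply: eq_integral => w _; rewrite muleCA -EFinM.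
- by apply/measurable_EFinP; exact: m1.
- by move=> w _; rewrite lee_fin mulr_ge0.
- by rewrite lee_fin.
Qed.

Lemma integral_tpow t : (0 < t < 1)%R ->
  \int[P]_w (F w * tpow t (N w))%:E = \sum_(k <oo) (t ^+ k)%:E * coeff k.
Proof.
move=> t01; rewrite -integral_nat_series; last first.
  by move=> k; rewrite exprn_ge0//; case/andP : t01 => /ltW.
by apply: eq_integral => w _; rewrite EFinM tpow_series.
Qed.

Lemma integral_nat_event C : ~ C +oo ->
  \int[P]_w (F w * \1_C (N w))%:E =
  \sum_(k <oo) (\1_C (k%:R%:E : \bar R))%:E * coeff k.
Proof.
move=> Coo; rewrite -integral_nat_series//.
apply: eq_integral => w _; rewrite EFinM; congr *%E.
have [[k ->]|->] := Nnat w; first by rewrite nneseries_indic_nat.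
by rewrite nneseries_indic_pinfty indicE memNset.
Qed.

Lemma sum_coeff_le1 : \sum_(k <oo) coeff k <= 1.
Proof.
rewrite (_ : \sum_(k <oo) _ = \sum_(k <oo) 1%:E * coeff k); last first.
  by apply: eq_eseriesr => k _; rewrite mul1e.
rewrite -(@integral_nat_series (fun=> 1%R))//.
rewrite [leRHS](_ : _ = \int[P]_w cst 1 w); last first.
  by rewrite integral_cst// mul1e; exact/esym/probability_setT.
apply: ge0_le_integral => //.
- move=> w _; rewrite mule_ge0 ?lee_fin//; apply: nneseries_ge0 => k _ _.
  by rewrite /= mul1e lee_fin.
- apply: emeasurable_funM; first exact/measurable_EFinP.
  apply: ge0_emeasurable_sum => [k w _ _|k _]; first by rewrite /= mul1e lee_fin.
  apply: measurable_funeM; apply/measurable_EFinP.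
  exact: (measurableT_comp (measurable_indic _) mN).
- move=> w _; rewrite -[leRHS]mule1; apply: lee_pmul => //; rewrite ?lee_fin//.
  + by apply: nneseries_ge0 => k _ _; rewrite mul1e lee_fin.
  + by have /andP[] := F01 w.
  + by have [[k ->]|->] := Nnat w;
      rewrite ?nneseries_indic_nat ?nneseries_indic_pinfty.
Qed.

Lemma integral_event_split C : measurable C ->
  \int[P]_w (F w)%:E = \int[P]_w (F w * \1_C (N w))%:E +
                       \int[P]_w (F w * \1_(~` C) (N w))%:E.
Proof.
move=> mC; rewrite -ge0_integralD//; last 4 first.
- by move=> w _; rewrite lee_fin mulr_ge0.
- by apply/measurable_EFinP; exact: m1.
- by move=> w _; rewrite lee_fin mulr_ge0.
- by apply/measurable_EFinP; apply: m1; exact: measurableC.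
apply: eq_integral => w _; rewrite -EFinD -mulrDr.
by rewrite !indicE in_setC; case: (_ \in _); rewrite ?(addr0, add0r) mulr1.
Qed.

Lemma integral_event_fin_num C : measurable C ->
  \int[P]_w (F w * \1_C (N w))%:E \is a fin_num.
Proof.
move=> mC; apply: integral_itv01_fin_num; first exact: m1.
by move=> w; rewrite mulr_ge0//= mulr_ile1//; have /andP[] := F01 w.
Qed.

End expansion.

(** Equality of power series identifies the weights of all finite counts, hence of every [C] that
    misses +oo. A set containing +oo is reached through its complement, which is where equality of
    the total weights of [F1] and [F2] enters. *)
Lemma pgf_determines d1 (T1 : measurableType d1) (P1 : probability T1 R)
    d2 (T2 : measurableType d2) (P2 : probability T2 R)
    (F1 : T1 -> R) (F2 : T2 -> R) (N1 : T1 -> \bar R) (N2 : T2 -> \bar R) :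
  measurable_fun setT F1 -> (forall w, (0 <= F1 w <= 1)%R) ->
  measurable_fun setT F2 -> (forall w, (0 <= F2 w <= 1)%R) ->
  measurable_fun setT N1 -> nat_valued N1 ->
  measurable_fun setT N2 -> nat_valued N2 ->
  (forall t, (0 < t < 1)%R -> \int[P1]_w (F1 w * tpow t (N1 w))%:E =
                              \int[P2]_w (F2 w * tpow t (N2 w))%:E) ->
  \int[P1]_w (F1 w)%:E = \int[P2]_w (F2 w)%:E ->
  forall C, measurable C ->
    \int[P1]_w (F1 w * \1_C (N1 w))%:E = \int[P2]_w (F2 w * \1_C (N2 w))%:E.
Proof.
move=> mF1 F101 mF2 F201 mN1 N1nat mN2 N2nat pgfE FE.
have cE : coeff P1 F1 N1 =1 coeff P2 F2 N2.
  apply: nneseries_coeff_inj => [k|k| | |t t01].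
  - exact: coeff_ge0.
  - exact: coeff_ge0.
  - exact: sum_coeff_le1.
  - exact: sum_coeff_le1.
  - by rewrite -!integral_tpow// pgfE.
have key C : ~ C +oo ->
    \int[P1]_w (F1 w * \1_C (N1 w))%:E = \int[P2]_w (F2 w * \1_C (N2 w))%:E.
  move=> Coo; rewrite !integral_nat_event//.
  by apply: eq_eseriesr => k _; rewrite cE.
move=> C mC; have [Coo|Coo] := pselect (C +oo); last exact: key.
have := FE; rewrite (@integral_event_split _ _ P1 _ _ mF1 F101 mN1 _ mC).
rewrite (@integral_event_split _ _ P2 _ _ mF2 F201 mN2 _ mC) (key (~` C)); last by move=> /(_ Coo).
move=> /(congr1 (fun x => x - \int[P2]_w (F2 w * \1_(~` C) (N2 w))%:E)).
by rewrite !addeK// integral_event_fin_num//; exact: measurableC.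
Qed.

End pgf.

(** * The Laplace functional of a Poisson process *)

Section poisson_laplace.
Local Open Scope ereal_scope.
Context {R : realType} d (T : measurableType d) (P : probability T R).
Context dX (X : measurableType dX).
Variable nu : {sigma_finite_measure set X -> \bar R}.
Variables (present : nat -> set T) (xi : nat -> T -> X) (lambda : R).
Hypothesis mpresent : forall j, measurable (present j).
Hypothesis mxi : forall j, measurable_fun setT (xi j).
Hypothesis lambda0 : (0 <= lambda)%R.

Definition num_pts (A : set X) (w : T) : \bar R :=
  counting [set j | present j w /\ A (xi j w)].

Hypothesis num_poisson : forall A, measurable A -> nu A < +oo ->
  forall k : nat, P [set w | num_pts A w = k%:R%:E] =
    poisson_prob (lambda * fine (nu A))%R 0 [set k].
Hypothesis num_indep : forall A : nat -> set X,
  (forall i, measurable (A i)) -> (forall i, nu (A i) < +oo) ->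
  trivIset setT A ->
  mutually_independent P (fun i => events_of (num_pts (A i))).

Lemma measurable_num_pts A : measurable A -> measurable_fun setT (num_pts A).
Proof.
move=> mA; apply: (measurable_counting (D := fun j => present j `&` xi j @^-1` A)).
move=> j; apply: measurableI => //.
by rewrite -[X in measurable X]setTI; exact: mxi.
Qed.

Lemma num_pts_nat A : nat_valued (num_pts A).
Proof. by move=> w; exact: counting_natP. Qed.

Lemma coeff1_num_pts A k : measurable A ->
  coeff P (cst 1%R) (num_pts A) k = P [set w | num_pts A w = k%:R%:E].
Proof.
move=> mA; rewrite /coeff; under eq_integral do rewrite mul1r.
transitivity (\int[P]_w (\1_[set w | num_pts A w = k%:R%:E] w)%:E).
  apply: eq_integral => w _; rewrite !indicE.
  suff -> : (num_pts A w \in [set k%:R%:E]) =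
    (w \in [set w | num_pts A w = k%:R%:E]) by [].
  by apply/idP/idP => /set_mem h; apply/mem_set.
rewrite integral_indic ?setIT//.
rewrite (_ : mkset _ = num_pts A @^-1` [set k%:R%:E])//.
by rewrite -[X in measurable X]setTI; exact: measurable_num_pts.
Qed.

Lemma pgf_num_pts A (t : R) : measurable A -> nu A < +oo -> (0 < t < 1)%R ->
  \int[P]_w (tpow t (num_pts A w))%:E =
  (expR (- (lambda * fine (nu A) * (1 - t))))%:E.
Proof.
move=> mA Aoo t01; have /andP[t0 t1] := t01.
transitivity (\int[P]_w (cst 1%R w * tpow t (num_pts A w))%:E).
  by apply: eq_integral => w _; rewrite mul1r.
rewrite integral_tpow//; last 3 first.
- by move=> w; rewrite ler01 lexx.
- exact: measurable_num_pts.
- exact: num_pts_nat.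
under eq_eseriesr => k _ do rewrite coeff1_num_pts// num_poisson//.
set r := (lambda * fine (nu A))%R.
have : (0 <= r)%R by rewrite mulr_ge0// fine_ge0.
clearbody r.
(* At rate 0 the law is a Dirac mass and not given by [poisson_pmf], so this case is computed
   apart. *)
rewrite le_eqVlt => /predU1P[<-|r0].
  rewrite mul0r oppr0 expR0 /poisson_prob ltxx.
  rewrite (@nneseriesD1 _ _ 0 xpredT)//; last first.
    by move=> k _; rewrite mule_ge0// lee_fin exprn_ge0// ltW.
  rewrite diracE mem_set// mule1 eseries0 ?adde0// => i _ i0.
  by rewrite diracE memNset ?mule0//= => /esym/eqP; apply/negP.
have tr0 : (0 < t * r)%R by rewrite mulr_gt0.
(* Tilting by t^k turns the Poisson law of rate [r] into a multiple of the one of rate [t * r],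
   whose total mass is 1; no exponential series has to be summed. *)
have pmfE k : (t ^+ k)%:E * poisson_prob r 0 [set k] =
    (expR (- (r * (1 - t))))%:E * (poisson_pmf (t * r)%R k)%:E.
  rewrite /poisson_prob r0 esum_set1 ?lee_fin ?poisson_pmf_ge0// -!EFinM.
  rewrite /poisson_pmf r0 tr0; congr EFin.
  have -> : (expR (- r) = expR (- (r * (1 - t))) * expR (- (t * r)))%R.
    by rewrite -expRD; congr expR; ring.
  by rewrite exprMn; ring.
under eq_eseriesr => k _ do rewrite pmfE.
rewrite nneseriesZl; last by move=> k _; rewrite lee_fin poisson_pmf_ge0.
rewrite nneseries_esumT; last by move=> k; rewrite lee_fin poisson_pmf_ge0.
have := @probability_setT _ _ _ (poisson_prob (t * r)%R 0).
rewrite /= /poisson_prob tr0 => psum.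
by rewrite -[RHS]mule1; congr (_ * _); exact: psum.
Qed.

Section disjoint_family.
Variable A : nat -> set X.
Hypotheses (mA : forall i, measurable (A i)) (Aoo : forall i, nu (A i) < +oo).
Hypothesis tA : trivIset setT A.
Let N i := num_pts (A i).

Let tpow01 t i w : (0 < t < 1)%R -> (0 <= tpow t (N i w) <= 1)%R.
Proof. by move=> t01; apply: tpow_itv01 => //; exact: num_pts_nat. Qed.

Let mtpow t i : (0 < t < 1)%R -> measurable_fun setT (fun w => tpow t (N i w)).
Proof.
move=> t01; apply: measurable_tpow_comp => //; last exact: num_pts_nat.
exact: measurable_num_pts.
Qed.

(** Independence is known for events only. The mixed statement allows an induction: a power in [s]
    is expanded into the events that its count equals [k], and each of these joins the indicators
    over [s'], where the induction hypothesis applies. *)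
Lemma indep_pgf (s s' : seq nat) (t : nat -> R) (C : nat -> set (\bar R)) :
  uniq (s ++ s') -> (forall i, (0 < t i < 1)%R) -> (forall i, measurable (C i)) ->
  \int[P]_w ((\prod_(i <- s) tpow (t i) (N i w)) *
             (\prod_(i <- s') \1_(C i) (N i w)))%:E =
  (\prod_(i <- s) \int[P]_w (tpow (t i) (N i w))%:E) *
  (\prod_(i <- s') P (N i @^-1` C i)).
Proof.
move=> us t01; elim: s s' C us => [|i s IH] s' C us mC.
  rewrite big_nil mul1e.
  have := num_indep mA Aoo tA => /(_ s' (fun i => N i @^-1` C i) us) <-; last first.
    by move=> i _; exists (C i) => //; rewrite setTI.
  set B := \big[setI/setT]_(i <- s') _.
  have mB : measurable B.
    rewrite /B; elim: s' {us B} => [|i s' IH]; first by rewrite big_nil.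
    rewrite big_cons; apply: measurableI => //.
    by rewrite -[X in measurable X]setTI; exact: measurable_num_pts.
  transitivity (\int[P]_w (\1_B w)%:E); last by rewrite integral_indic// setIT.
  apply: eq_integral => w _; congr EFin; rewrite big_nil mul1r /B.
  elim: s' {us B mB} => [|i s' IH]; first by rewrite !big_nil indicT.
  by rewrite !big_cons IH indicI.
pose F w := ((\prod_(j <- s) tpow (t j) (N j w)) *
             (\prod_(j <- s') \1_(C j) (N j w)))%R.
have F01 w : (0 <= F w <= 1)%R.
  have /andP[a0 a1] := prod_seq_itv01 s (fun j => tpow01 j w (t01 j)).
  have ind01 j : (0 <= (\1_(C j) (N j w) : R) <= 1)%R.
    by rewrite indicE; case: (_ \in _); rewrite ?lexx ?ler01.
  have /andP[b0 b1] := prod_seq_itv01 s' ind01.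
  by rewrite /F mulr_ge0//= mulr_ile1.
have mF : measurable_fun setT F.
  apply: measurable_funM; apply: measurable_prod => j _; first exact: mtpow.
  exact: (measurableT_comp (measurable_indic (mC j)) (measurable_num_pts (mA j))).
transitivity (\int[P]_w (F w * tpow (t i) (N i w))%:E).
  by apply: eq_integral => w _; rewrite big_cons /F -mulrA mulrC.
rewrite integral_tpow//; [|exact: measurable_num_pts|exact: num_pts_nat].
move: us; rewrite /= => /andP[is' us].
(* The event for the new index [i] is inserted into the family; since [i] does not occur in [s'],
   the other events keep their [C j]. *)
pose D k j := if j == i then [set k%:R%:E] else C j.
have coeffE k : coeff P F (N i) k =
    (\prod_(j <- s) \int[P]_w (tpow (t j) (N j w))%:E) *
    (\prod_(j <- s') P (N j @^-1` C j)) *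
    coeff P (cst 1%R) (N i) k.
  have Dne j : j \in s' -> D k j = C j.
    move=> js'; rewrite /D; case: eqP => // ji; move: is'.
    by rewrite mem_cat -ji js' orbT.
  have mD j : measurable (D k j) by rewrite /D; case: ifP.
  have us' : uniq (s ++ i :: s') by rewrite -cat1s uniq_catCA /= is' us.
  have := IH (i :: s') (D k) us' mD.
  have Di : D k i = [set k%:R%:E] by rewrite /D eqxx.
  rewrite big_cons Di.
  rewrite [X in _ = _ * (_ * X)](eq_big_seq (fun j => P (N j @^-1` C j)));
    last first.
    by move=> j js'; rewrite Dne.
  move=> IHk; rewrite (coeff1_num_pts k (mA i)) [RHS]muleC [RHS]muleCA.
  apply: eq_trans IHk.
  apply: eq_integral => w _; rewrite big_cons Di /F; congr EFin.
  rewrite -mulrA; congr (_ * _)%R; rewrite mulrC; congr (_ * _)%R.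
  by apply: eq_big_seq => j js'; rewrite Dne.
under eq_eseriesr => k _ do rewrite coeffE.
rewrite -IH// -/(F _); set c := \int[P]_w _.
have cfin : c \is a fin_num by exact: integral_itv01_fin_num.
rewrite -(fineK cfin); under eq_eseriesr => k _ do rewrite muleCA.
rewrite nneseriesZl; last first.
  move=> k _; rewrite mule_ge0//; last by apply: coeff_ge0 => w; rewrite ler01 lexx.
  by rewrite lee_fin exprn_ge0//; case/andP : (t01 i) => /ltW.
rewrite (fineK cfin) big_cons -muleA -IH// muleC; congr (_ * _).
rewrite -integral_tpow//; last 3 first.
- by move=> w; rewrite ler01 lexx.
- exact: measurable_num_pts.
- exact: num_pts_nat.
by apply: eq_integral => w _; rewrite mul1r.
Qed.

Lemma indep_pgf_all (n : nat) (t : nat -> R) : (forall i, (0 < t i < 1)%R) ->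
  \int[P]_w (\prod_(0 <= i < n) tpow (t i) (N i w))%:E =
  (expR (- (lambda * \sum_(0 <= i < n) (fine (nu (A i)) * (1 - t i)))))%:E.
Proof.
move=> t01; have := @indep_pgf (index_iota 0 n) [::] t (fun=> setT).
rewrite cats0 iota_uniq big_nil mule1 => /(_ isT t01 (fun=> measurableT)) h.
transitivity (\int[P]_w ((\prod_(i <- index_iota 0 n) tpow (t i) (N i w)) *
             (\prod_(i <- [::]) \1_(setT : set (\bar R)) (N i w)))%:E).
  by apply: eq_integral => w _; rewrite big_nil mulr1.
rewrite h; under eq_bigr => i _ do rewrite pgf_num_pts//.
rewrite prodEFin mulr_sumr -sumrN expR_sum; congr EFin.
by apply: eq_bigr => i _; rewrite mulrA.
Qed.

(** Interchanging the products over labels and over sets turns the left side into a product of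
    powers of independent counts. On the right, disjointness leaves at most one factor of [G]
    different from 1, so [1 - G] is the sum of the [1 - t i] on the [A i]. *)
Lemma poisson_laplace_step (n : nat) (t : nat -> R) (G : X -> R) :
  (forall i, (0 < t i < 1)%R) ->
  (forall x, G x = \prod_(0 <= i < n) (if x \in A i then t i else 1))%R ->
  \int[P]_w (iprod (fun j => if w \in present j then G (xi j w) else 1%R))%:E =
  expeR (- (lambda%:E * \int[nu]_x (1 - G x)%:E)).
Proof.
move=> t01 G_E.
have GE w : iprod (fun j => if w \in present j then G (xi j w) else 1%R) =
    (\prod_(0 <= i < n) tpow (t i) (N i w))%R.
  rewrite (_ : (fun j => _) = (fun j => \prod_(0 <= i < n)
    (if j \in [set j | present j w /\ A i (xi j w)] then t i else 1))%R).
    rewrite iprod_prod; last first.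
      move=> i j; case: ifP; rewrite ?ler01 ?lexx// => _.
      by have /andP[/ltW -> /ltW ->] := t01 i.
    apply: eq_bigr => i _; rewrite iprod_tpow//.
    by have /andP[/ltW -> ->] := t01 i.
  apply/funext => j; have [wj|wj] := boolP (w \in present j); last first.
    rewrite big1// => i _; rewrite memNset//= => -[/mem_set h _].
    by rewrite h in wj.
  rewrite G_E; apply: eq_bigr => i _; congr (if _ then _ else _).
  apply/idP/idP => [/set_mem h|/set_mem[_ h]]; last exact/mem_set.
  by apply/mem_set; split => //; exact/set_mem.
under eq_integral do rewrite GE.
rewrite indep_pgf_all//.
have -> : \int[nu]_x (1 - G x)%:E =
    (\sum_(0 <= i < n) (fine (nu (A i)) * (1 - t i)))%:E.
  transitivity (\int[nu]_x \sum_(0 <= i < n) ((1 - t i)%:E * (\1_(A i) x)%:E)).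
    apply: eq_integral => x _; rewrite G_E.
    under [RHS]eq_bigr do rewrite -EFinM.
    rewrite sumEFin; congr EFin.
    have [[k /= kn Akx]|h] := pselect (exists2 k, (k < n)%N & A k x); last first.
      rewrite !big_nat big1 => [|i /andP[_ ilt]]; last first.
        by rewrite memNset// => Aix; apply: h; exists i.
      rewrite subrr big1// => i /andP[_ ilt].
      by rewrite indicE memNset ?mulr0// => Aix; apply: h; exists i.
    have Ai i : i != k -> (x \in A i) = false.
      move=> ik; apply/negbTE/negP => /set_mem Aix.
      move/trivIsetP : tA => /(_ i k Logic.I Logic.I ik).
      by move/seteqP => [/(_ x) + _]; apply.
    rewrite !big_mkord (bigD1 (Ordinal kn))//= [RHS](bigD1 (Ordinal kn))//=.
    rewrite mem_set// big1 => [|i]; last first.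
      by rewrite -val_eqE => /= ik; rewrite Ai.
    rewrite [X in _ = (_ + X)%R]big1 => [|i]; last first.
      by rewrite -val_eqE => /= ik; rewrite indicE Ai// mulr0.
    by rewrite indicE mem_set// !mulr1 addr0.
  rewrite ge0_integral_sum//; last 2 first.
  - move=> i; apply: measurable_funeM; apply/measurable_EFinP.
    exact: measurable_indic.
  - move=> i x _; rewrite -EFinM lee_fin mulr_ge0// subr_ge0.
    by case/andP : (t01 i) => _ /ltW.
  rewrite -sumEFin; apply: eq_bigr => i _.
  rewrite ge0_integralZl//; last 2 first.
  - exact/measurable_EFinP/measurable_indic.
  - by rewrite lee_fin subr_ge0; case/andP : (t01 i) => _ /ltW.
  rewrite integral_indic// setIT muleC EFinM fineK// ge0_fin_numE//.
by rewrite -EFinM.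
Qed.

End disjoint_family.
Import HBNNSimple.

Lemma measurable_marked (G : X -> R) j : measurable_fun setT G ->
  measurable_fun setT (fun w => if w \in present j then G (xi j w) else 1%R).
Proof.
move=> mG; apply: measurable_fun_ifT => //; first exact: measurable_fun_mem.
exact: measurableT_comp.
Qed.

(** The nonzero values v of [phi] provide the disjoint sets where [phi] is v, cut down to [F] to
    have finite measure, with parameter 1 - v; [phi < 1] makes that parameter positive. *)
Lemma poisson_laplace_nnsfun (phi : {nnsfun X >-> R}) (F : set X) :
  (forall x, (phi x < 1)%R) -> measurable F -> nu F < +oo ->
  \int[P]_w (iprod (fun j => if w \in present j
    then (1 - phi (xi j w) * \1_F (xi j w)) else 1)%R)%:E =
  expeR (- (lambda%:E * \int[nu]_x (phi x * \1_F x)%:E)).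
Proof.
move=> phi1 mF Foo.
have finr : finite_set (range phi `\ 0%R) by exact: finite_setD.
have /finite_seqP[s0 s0E] := finr.
pose s := undup s0.
have us : uniq s by exact: undup_uniq.
have sP v : v \in s -> (range phi `\ 0%R) v by rewrite mem_undup s0E.
have Ps v : (range phi `\ 0%R) v -> v \in s by rewrite mem_undup s0E.
pose A i := if (i < size s)%N then phi @^-1` [set s`_i] `&` F else set0.
(* Beyond the list of values the sets are empty, and 1/2 is a filler in the open unit interval. *)
pose t i := if (i < size s)%N then (1 - s`_i)%R else 2^-1%R.
have t01 i : (0 < t i < 1)%R.
  rewrite /t; case: ifPn => [ilt|_]; last first.
    by rewrite invr_gt0 ltr0n/= invf_lt1// ltr1n.
  have [[x _ <-] /eqP phi0] := sP _ (mem_nth 0%R ilt).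
  rewrite subr_gt0 phi1/= ltrBlDr ltrDl lt_neqAle eq_sym phi0/=.
  exact: fun_ge0.
have mA i : measurable (A i).
  rewrite /A; case: ifPn => // _; exact: measurableI.
have Aoo i : nu (A i) < +oo.
  apply: le_lt_trans Foo; apply: le_measure; rewrite ?inE//.
  by rewrite /A; case: ifPn => _; [exact: subIsetr|exact: sub0set].
have tA : trivIset setT A.
  move=> i j _ _ [x []]; rewrite /A.
  case: ifPn => // ilt [/= ix _]; case: ifPn => // jlt [/= jx _].
  by apply/eqP; rewrite -(nth_uniq 0%R ilt jlt us) -ix -jx.
have GE x : (1 - phi x * \1_F x =
    \prod_(0 <= i < size s) (if x \in A i then t i else 1))%R.
  have [[Fx phi0]|h] := pselect (F x /\ phi x != 0%R).
    have xs : phi x \in s.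
      by apply: Ps; split; [exists x|move=> /= h; rewrite h eqxx in phi0].
    pose k := index (phi x) s.
    have kn : (k < size s)%N by rewrite index_mem.
    have Ak : A k x by rewrite /A kn; split => //=; rewrite nth_index.
    rewrite big_mkord (bigD1 (Ordinal kn))//= mem_set// big1 ?mulr1 => [|i].
      by rewrite /t kn /k nth_index// indicE mem_set// mulr1.
    rewrite -val_eqE => /= /eqP ik; rewrite memNset// => Aix; apply: ik.
    by apply: (tA i k) => //; exists x.
  rewrite big1 => [|i _]; last first.
    rewrite memNset// /A; case: ifPn => [ilt [/= ix Fx]|_ []//].
    by apply: h; split => //; rewrite ix; have [_ /eqP] := sP _ (mem_nth 0%R ilt).
  have [Fx|Fx] := pselect (F x); last by rewrite indicE memNset// mulr0 subr0.
  have -> : phi x = 0%R by apply/eqP; apply: contra_notT h.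
  by rewrite mul0r subr0.
rewrite (poisson_laplace_step mA Aoo tA (G := fun x => 1 - phi x * \1_F x)%R t01 GE).
congr (expeR (- (_ * _))); apply: eq_integral => x _.
by rewrite opprB addrC subrK.
Qed.

(** Simple functions cut off to sets of finite measure increase to [1 - G]. The left sides converge
    by [cvg_iprod] and bounded convergence, since the factors decrease to [G]; the right sides
    converge by monotone convergence, possibly to exponent +oo. *)
Lemma poisson_laplace (G : X -> R) : measurable_fun setT G ->
  (forall x, (0 < G x <= 1)%R) ->
  \int[P]_w (iprod (fun j => if w \in present j then G (xi j w) else 1%R))%:E =
  expeR (- (lambda%:E * \int[nu]_x (1 - G x)%:E)).
Proof.
move=> mG G01.
pose h x := (1 - G x)%R.
have h0 x : (0 <= h x)%R by rewrite subr_ge0; case/andP : (G01 x).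
have h1 x : (h x < 1)%R by rewrite ltrBlDr ltrDl; case/andP : (G01 x).
have mh : measurable_fun setT (EFin \o h).
  by apply/measurable_EFinP; exact: measurable_funB.
pose phi := nnsfun_approx measurableT mh.
have phih x : phi m x @[m --> \oo] --> h x.
  have : EFin \o phi ^~ x @ \oo --> (h x)%:E.
    by apply: (cvg_nnsfun_approx measurableT mh) => // y _; rewrite lee_fin.
  by move=> /fine_cvgP[].
have ndphi x : nondecreasing_seq (phi ^~ x).
  by move=> m n mn; exact/lefP/nd_nnsfun_approx.
have phi_le m x : (phi m x <= h x)%R.
  rewrite -(cvg_lim _ (phih x))//; apply: nondecreasing_cvgn_le => //.
  by apply/cvg_ex; exists (h x).
have /sigma_finiteP[F [FT ndF Foo]] := sigma_finiteT nu.
pose H m x := (phi m x * \1_(F m) x)%R.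
have H_ge0 m x : (0 <= H m x)%R by rewrite mulr_ge0.
have Hh m x : (H m x <= h x)%R.
  apply: le_trans (phi_le m x); rewrite /H indicE; case: (_ \in _).
    by rewrite mulr1.
  by rewrite mulr0.
have ndH x : nondecreasing_seq (H ^~ x).
  move=> m n mn; rewrite /H ler_pM//; first exact: ndphi.
  rewrite !indicE; have [xm|_] := boolP (x \in F m); last by case: (_ \in _).
  rewrite mem_set//; have /subsetPset := ndF _ _ mn; apply; exact/set_mem.
have cvgH x : H m x @[m --> \oo] --> h x.
  have [k _ Fk] : (\bigcup_k F k) x by rewrite -FT.
  (* Once [x] lies in the exhausting sets the cut-off has no effect at [x]. *)
  apply: cvg_trans (phih x); apply: near_eq_cvg; near=> m.
  rewrite /H indicE mem_set ?mulr1//.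
  have km : (k <= m)%N by near: m; exists k.
  by have /subsetPset := ndF _ _ km; apply.
have mH m : measurable_fun setT (H m).
  apply: measurable_funM => //.
  by apply: measurable_indic; case: (Foo m).
have H01 m x : (0 <= 1 - H m x <= 1)%R.
  rewrite subr_ge0 (le_trans (Hh m x) (ltW (h1 x)))/=.
  by rewrite lerBlDr lerDl.
have hG x : (1 - h x)%R = G x by rewrite /h opprB addrC subrK.
pose u m w j := (if w \in present j then 1 - H m (xi j w) else 1)%R.
pose v w j := (if w \in present j then G (xi j w) else 1)%R.
have u01 m w j : (0 <= u m w j <= 1)%R.
  by rewrite /u; case: ifP; rewrite ?ler01 ?lexx.
have v01 w j : (0 <= v w j <= 1)%R.
  rewrite /v; case: ifP; rewrite ?ler01 ?lexx// => _.
  by case/andP: (G01 (xi j w)) => /ltW -> ->.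
have cvgL : \int[P]_w (iprod (u m w))%:E @[m --> \oo] --> \int[P]_w (iprod (v w))%:E.
  apply: bounded_cvg_integral.
  - move=> m; apply: (measurable_iprod (u := fun j w => u m w j)) => [j w|j].
      exact: u01.
    apply: (@measurable_marked (fun x => 1 - H m x)%R); exact: measurable_funB.
  - apply: (measurable_iprod (u := fun j w => v w j)) => [j w|j]; first exact: v01.
    exact: (@measurable_marked G).
  - by move=> m w; exact/iprod_itv01/u01.
  - move=> w; apply: cvg_iprod => [m j|m j|j|j].
    + exact: u01.
    + by rewrite /u /v; case: ifP => // _; rewrite -hG lerB.
    + by have /andP[] := v01 w j.
    + rewrite /u /v; case: ifP => // _; last exact: cvg_cst.
      by rewrite -hG; apply: cvgB; [exact: cvg_cst|exact: cvgH].
have uE m : \int[P]_w (iprod (u m w))%:E =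
    expeR (- (lambda%:E * \int[nu]_x (H m x)%:E)).
  have [mFm Fmoo] := Foo m; apply: poisson_laplace_nnsfun => //.
  by move=> x; exact: le_lt_trans (phi_le m x) (h1 x).
have cvgR : expeR (- (lambda%:E * \int[nu]_x (H m x)%:E)) @[m --> \oo] -->
    expeR (- (lambda%:E * \int[nu]_x (h x)%:E)).
  apply: cvg_expeRN => [|m]; last first.
    by rewrite mule_ge0// ?lee_fin// integral_ge0// => x _; rewrite lee_fin.
  apply: cvgeZl => //.
  rewrite [X in _ --> X](_ : _ = \int[nu]_x limn (fun m => (H m x)%:E)).
    apply: cvg_monotone_convergence => //.
    + by move=> m; exact/measurable_EFinP.
    + by move=> m x _; rewrite lee_fin.
    + by move=> x _ m n mn; rewrite lee_fin; exact: ndH.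
  apply: eq_integral => x _; apply/esym/cvg_lim => //.
  by apply/cvg_EFin; [exact: nearW|exact: cvgH].
have := cvgL; under eq_fun do rewrite uE.
by move=> cvgL'; rewrite -(cvg_lim _ cvgL')// (cvg_lim _ cvgR).
Unshelve. all: by end_near. Qed.

End poisson_laplace.

(** * Integrating out independent marks *)

Section pushm_probability.
Local Open Scope ereal_scope.
Context d1 d2 (T1 : measurableType d1) (T2 : measurableType d2) (R : realType).
Variables (P : probability T1 R) (f : T1 -> T2) (mf : measurable_fun setT f).

Let pushm_setT : pushm P mf setT = 1.
Proof. by rewrite /pushm /pushforward preimage_setT; exact: probability_setT. Qed.

HB.instance Definition _ :=
  Measure_isProbability.Build _ _ _ (pushm P mf) pushm_setT.

End pushm_probability.

Section independence.
Local Open Scope ereal_scope.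
Context {R : realType} d (T : measurableType d) (P : probability T R).
Context d0 (T0 : measurableType d0) (P0 : probability T0 R).
Context dY (Y : measurableType dY).
Variables (G : set (set T)) (M : T -> Y) (M0 : T0 -> Y).
Hypotheses (mM : measurable_fun setT M) (mM0 : measurable_fun setT M0).
Hypotheses (Gm : G `<=` measurable) (GI : setI_closed G) (GT : G setT).
Hypothesis indep : forall A C, G A -> measurable C ->
  P (A `&` M @^-1` C) = P A * P0 (M0 @^-1` C).

Let preM C : measurable C -> measurable (M @^-1` C).
Proof. by move=> mC; rewrite -[X in measurable X]setTI; exact: mM. Qed.

(** As functions of [A] both sides are finite measures that agree on a pi-system containing the
    whole space. *)
Lemma indep_g_sigma A C : <<s G >> A -> measurable C ->
  P (A `&` M @^-1` C) = P A * P0 (M0 @^-1` C).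
Proof.
move=> GA mC.
have mM0C : measurable (M0 @^-1` C).
  by rewrite -[X in measurable X]setTI; exact: mM0.
have fin0 : P0 (M0 @^-1` C) \is a fin_num by exact: fin_num_measure.
have k0 : (0 <= fine (P0 (M0 @^-1` C)))%R by rewrite fine_ge0.
pose m1 : {measure set T -> \bar R} := mrestr P (preM mC).
pose m2 : {measure set T -> \bar R} := mscale (NngNum k0) P.
have m2E B : m2 B = P B * P0 (M0 @^-1` C).
  by rewrite muleC -(fineK fin0).
have cover : \bigcup_(k in [set: nat]) (setT : set T) = setT.
  by rewrite bigcup_const//; exists 0%N.
have m12 B : G B -> m1 B = m2 B by move=> GB; rewrite m2E -indep.
have m1oo (k : nat) : m1 setT < +oo.
  by rewrite /m1 /= /mrestr setTI -ge0_fin_numE// fin_num_measure//; exact: preM.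
by have := g_sigma_algebra_measure_unique G Gm (fun=> setT) (fun=> GT) cover m1 m2 GI m12 m1oo A GA;
  rewrite m2E.
Qed.

(** The identity of [T] is viewed as a random variable into [T] with the smaller sigma-algebra
    generated by [G]. Its joint law with [M] is then a product measure, and Tonelli replaces [M] by
    an independent copy. *)
Lemma indep_integral (f : g_sigma_algebraType G * Y -> \bar R) :
  measurable_fun setT f -> (forall p, 0 <= f p) ->
  \int[P]_w f (w, M w) = \int[P]_w \int[P0]_z f (w, M0 z).
Proof.
move=> mf f0.
have mid : measurable_fun setT (id : T -> g_sigma_algebraType G).
  move=> _ B mB; rewrite setTI preimage_id.
  by apply: (smallest_sub (@sigma_algebra_measurable _ T) Gm); exact: mB.
have mp : measurable_fun [set: T] (fun w : T => (w : g_sigma_algebraType G, M w)).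
  by apply: measurable_fun_pair; [exact: mid|exact: mM].
pose mu := pushm P mid; pose nu := pushm P0 mM0.
rewrite -(ge0_integral_pushm P mp)//.
rewrite (@eq_measure_integral _ _ _ _ (mu \x nu)); last first.
  move=> A mA _; apply/esym/product_measure_unique => // B C mB mC.
  by rewrite /pushm /pushforward -[RHS]indep_g_sigma.
rewrite (fubini_tonelli1 f)//.
rewrite /mu ge0_integral_pushm//; last 2 first.
- exact: measurable_fun_fubini_tonelli_F.
- by move=> x; exact: integral_ge0.
apply: eq_integral => w _; rewrite /fubini_F /nu ge0_integral_pushm//.
exact: (measurableT_comp mf (pair1_measurable _)).
Qed.

End independence.

Section marks.
Local Open Scope ereal_scope.
Context {R : realType} d (T : measurableType d) (P : probability T R).
Context d0 (T0 : measurableType d0) (P0 : probability T0 R).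
Context dX (X : measurableType dX) dY (Y : measurableType dY).
Variables (present : nat -> set T) (xi : nat -> T -> X) (M : nat -> T -> Y).
Variable M0 : T0 -> Y.
Hypothesis mpresent : forall j, measurable (present j).
Hypothesis mxi : forall j, measurable_fun setT (xi j).
Hypothesis mM : forall j, measurable_fun setT (M j).
Hypothesis mM0 : measurable_fun setT M0.
Let loc := <<s \bigcup_j ([set present j] `|` events_of (xi j)) >>.
Hypothesis law : forall j C, measurable C -> P (M j @^-1` C) = P0 (M0 @^-1` C).
Hypothesis indep : mutually_independent P
  (fun i : option nat => if i is Some j then events_of (M j) else loc).

Variable phi : X * Y -> R.
Hypothesis mphi : measurable_fun setT phi.
Hypothesis phi01 : forall p, (0 <= phi p <= 1)%R.

Definition mark_mean (x : X) : R := fine (\int[P0]_z (phi (x, M0 z))%:E).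

Let mphi1 x : measurable_fun setT (fun z => phi (x, M0 z)).
Proof.
apply: (measurableT_comp mphi); apply: measurable_fun_pair => //.
Qed.

Lemma EFin_mark_mean x : (mark_mean x)%:E = \int[P0]_z (phi (x, M0 z))%:E.
Proof. by rewrite /mark_mean fineK//; exact: integral_itv01_fin_num. Qed.

Lemma mark_mean01 x : (0 <= mark_mean x <= 1)%R.
Proof. by rewrite -!lee_fin EFin_mark_mean; exact: integral_itv01. Qed.

Lemma measurable_mark_mean : measurable_fun setT mark_mean.
Proof.
apply/measurable_EFinP; rewrite (_ : _ \o _ =
    fubini_F P0 (fun p : X * T0 => (phi (p.1, M0 p.2))%:E)); last first.
  by apply/funext => x /=; rewrite EFin_mark_mean.
apply: measurable_fun_fubini_tonelli_F.
  apply/measurable_EFinP; apply: (measurableT_comp mphi).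
  by apply: measurable_fun_pair => //; exact: measurableT_comp.
by move=> p; rewrite lee_fin; case/andP: (phi01 (p.1, M0 p.2)).
Qed.

(* The pi-system generated by the locations and the first [n] marks. *)
Let G n : set (set T) := [set A | exists L (C : nat -> set Y),
  [/\ loc L, forall i, measurable (C i) &
      A = L `&` \big[setI/setT]_(0 <= i < n) (M i @^-1` C i)]].

Let loc_measurable : loc `<=` measurable.
Proof.
apply: smallest_sub; first exact: sigma_algebra_measurable.
move=> A [j _ [->//|[B mB <-]]]; exact: mxi.
Qed.

Let Gm n : G n `<=` measurable.
Proof.
move=> A [L [C [Lloc mC ->]]]; apply: measurableI; first exact: loc_measurable.
apply: bigsetI_measurable => i _.
by rewrite -[X in measurable X]setTI; exact: mM.
Qed.

Let locT : loc setT.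
Proof. by rewrite -setC0; apply: sigma_algebraC; exact: sigma_algebra0. Qed.

Let GT n : G n setT.
Proof.
exists setT, (fun=> setT); split => //.
by rewrite setTI big1// => i _; rewrite preimage_setT.
Qed.

Let GI n : setI_closed (G n).
Proof.
move=> _ _ [L [C [Ll mC ->]]] [L' [C' [Ll' mC' ->]]].
exists (L `&` L'), (fun i => C i `&` C' i); split.
- exact: (@measurableI _ (g_sigma_algebraType _) _ _ Ll Ll').
- by move=> i; exact: measurableI.
- under [in RHS]eq_bigr do rewrite preimage_setI.
  by rewrite big_split/= setIACA.
Qed.

Let indepG n A C : G n A -> measurable C ->
  P (A `&` M n @^-1` C) = P A * P0 (M0 @^-1` C).
Proof.
have key m L (D : nat -> set Y) : loc L -> (forall i, measurable (D i)) ->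
    P (L `&` \big[setI/setT]_(0 <= i < m) (M i @^-1` D i)) =
    P L * \prod_(0 <= i < m) P (M i @^-1` D i).
  move=> Lloc mD.
  (* [None] is the index of the location sigma-algebra, [Some i] that of mark [i]. *)
  have := @indep (None :: [seq Some i | i <- index_iota 0 m])
    (fun o => if o is Some i then M i @^-1` D i else L).
  rewrite !big_cons !big_map; apply.
    rewrite cons_uniq map_inj_uniq ?iota_uniq ?andbT => [|i j []//].
    by apply/mapP => -[].
  by move=> [i|] _ //; exists (D i) => //; rewrite setTI.
move=> [L [D [Lloc mD ->]]] mC.
pose D' i := if i == n then C else D i.
have D'E i : (i < n)%N -> D' i = D i by move=> ilt; rewrite /D' ltn_eqF.
have := key n.+1 L D' Lloc; rewrite !big_nat_recr//=.
have -> : D' n = C by rewrite /D' eqxx.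
rewrite (eq_big_nat _ _ (F2 := fun i => M i @^-1` D i)); last first.
  by move=> i /andP[_ ilt]; rewrite D'E.
rewrite (eq_big_nat _ _ (F2 := fun i => P (M i @^-1` D i))); last first.
  by move=> i /andP[_ ilt]; rewrite D'E.
rewrite setIA => -> => [|i]; last by rewrite /D'; case: ifP.
by rewrite key// muleA law.
Qed.

Let a j w : R := if w \in present j then phi (xi j w, M j w) else 1%R.
Let b j w : R := if w \in present j then mark_mean (xi j w) else 1%R.

Let a01 j w : (0 <= a j w <= 1)%R.
Proof. by rewrite /a; case: ifP; rewrite ?lexx ?ler01. Qed.

Let b01 j w : (0 <= b j w <= 1)%R.
Proof. by rewrite /b; case: ifP; rewrite ?lexx ?ler01 ?mark_mean01. Qed.

Let locG n L : loc L -> measurable (L : set (g_sigma_algebraType (G n))).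
Proof.
move=> Lloc; apply: sub_sigma_algebra; exists L, (fun=> setT); split => //.
by rewrite big1 ?setIT// => i _; rewrite preimage_setT.
Qed.

Let presentG n j : measurable (present j : set (g_sigma_algebraType (G n))).
Proof.
by apply: locG; apply: sub_sigma_algebra; exists j => //; left.
Qed.

Let xiG n j : measurable_fun setT (xi j : g_sigma_algebraType (G n) -> X).
Proof.
move=> _ B mB; rewrite setTI; apply: locG; apply: sub_sigma_algebra.
by exists j => //; right; exists B => //; rewrite setTI.
Qed.

Let MG n j : (j < n)%N -> measurable_fun setT (M j : g_sigma_algebraType (G n) -> Y).
Proof.
move=> jn _ B mB; rewrite setTI; apply: sub_sigma_algebra.
exists setT, (fun i => if i == j then B else setT); split => //.
  by move=> i; case: ifP.
rewrite setTI big_mkord (bigD1 (Ordinal jn))//= eqxx big1 ?setIT// => i.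
by rewrite -val_eqE => /= /negbTE ->; rewrite preimage_setT.
Qed.

Let aG n j : (j < n)%N -> measurable_fun setT (a j : g_sigma_algebraType (G n) -> R).
Proof.
move=> jn; apply: measurable_fun_ifT => //; first exact: measurable_fun_mem.
apply: (measurableT_comp mphi); apply: measurable_fun_pair; first exact: xiG.
exact: MG.
Qed.

Let bG n j : measurable_fun setT (b j : g_sigma_algebraType (G n) -> R).
Proof.
apply: measurable_fun_ifT => //; first exact: measurable_fun_mem.
exact: (measurableT_comp measurable_mark_mean (xiG j)).
Qed.

(** Hybrids between the product with true marks, [n = m], and the product with averaged marks,
    [n = 0]. The length [m] stays finite so that finitely many exchanges suffice. *)
Let hyb n m w := (\prod_(j < m) (if (j < n)%N then a j w else b j w))%R.

(** Apart from factor [n], both hybrids consist of the same factors [W], which involve only the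
    locations and the marks below [n], later marks being already averaged. Mark [n] is independent
    of all this and can be integrated out. *)
Let hybS n m : (n < m)%N ->
  \int[P]_w (hyb n.+1 m w)%:E = \int[P]_w (hyb n m w)%:E.
Proof.
move=> nm; pose W w := (\prod_(j < m | j != Ordinal nm)
  (if (j < n)%N then a j w else b j w))%R.
have W0 w : (0 <= W w)%R.
  by apply: prodr_ge0 => i _; case: ifP => _;
    [have /andP[] := a01 i w|have /andP[] := b01 i w].
have mW : measurable_fun setT (W : g_sigma_algebraType (G n) -> R).
  rewrite (_ : W = fun w => \prod_(j < m) (if j != Ordinal nm then
    (if (j < n)%N then a j w else b j w) else 1))%R; last first.
    by apply/funext => w; rewrite /W big_mkcond.
  apply: measurable_prod => i _; case: (i != _) => //.
  by case: (ltnP i n) => [jn|_]; [exact: aG|exact: bG].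
have hE1 w : hyb n.+1 m w = (W w * a n w)%R.
  rewrite /hyb (bigD1 (Ordinal nm))//= ltnSn mulrC; congr (_ * _)%R.
  apply: eq_bigr => i; rewrite -val_eqE/= => ni.
  by rewrite ltnS leq_eqVlt (negbTE ni).
have hE2 w : hyb n m w = (W w * b n w)%R.
  by rewrite /hyb (bigD1 (Ordinal nm))//= ltnn mulrC.
under eq_integral do rewrite hE1.
under [in RHS]eq_integral do rewrite hE2.
pose f (p : g_sigma_algebraType (G n) * Y) : \bar R :=
  (W p.1 * (if (p.1 : T) \in present n then phi (xi n p.1, p.2) else 1))%:E.
have mf : measurable_fun setT f.
  apply/measurable_EFinP; apply: measurable_funM; first exact: measurableT_comp.
  apply: measurable_fun_ifT => //.
    apply: (measurableT_comp (measurable_fun_mem (@presentG n n))) => //.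
  apply: (measurableT_comp mphi); apply: measurable_fun_pair => //.
  exact: (measurableT_comp (@xiG n n)).
have f0 p : 0 <= f p.
  rewrite lee_fin mulr_ge0//; case: ifP => // _.
  by case/andP: (phi01 (xi n p.1, p.2)).
rewrite (indep_integral (mM n) mM0 (@Gm n) (@GI n) (@GT n) (@indepG n) mf f0).
apply: eq_integral => w _; rewrite /f /=.
under eq_integral do rewrite EFinM.
rewrite /b; case: ifP => _.
  rewrite ge0_integralZl//; last 3 first.
  - exact/measurable_EFinP.
  - by move=> z _; rewrite lee_fin; case/andP: (phi01 (xi n w, M0 z)).
  - by rewrite lee_fin.
  by rewrite -EFin_mark_mean.
rewrite integral_cst// [X in _ * X](_ : _ = 1) ?mule1 ?mulr1//.
exact: probability_setT.
Qed.

Lemma mark_mean_iprod :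
  \int[P]_w (iprod (a^~ w))%:E = \int[P]_w (iprod (b^~ w))%:E.
Proof.
have ma j : measurable_fun setT (a j).
  apply: measurable_fun_ifT => //; first exact: measurable_fun_mem.
  by apply: (measurableT_comp mphi); exact: measurable_fun_pair.
have mb j : measurable_fun setT (b j).
  apply: measurable_fun_ifT => //; first exact: measurable_fun_mem.
  exact: (measurableT_comp measurable_mark_mean (mxi j)).
have cvgP (c : nat -> T -> R) : (forall j w, (0 <= c j w <= 1)%R) ->
    (forall j, measurable_fun setT (c j)) ->
    \int[P]_w (\prod_(j < m) c j w)%:E @[m --> \oo] --> \int[P]_w (iprod (c^~ w))%:E.
  move=> c01 mc; apply: (bounded_cvg_integral (f := fun m w => \prod_(j < m) c j w)%R).
  - by move=> m; apply: (measurable_prod (h := fun (j : 'I_m) w => c j w)).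
  - exact: (measurable_iprod (u := c)).
  - by move=> m w; exact: (prod_itv01 (u := fun j => c j w)).
  - by move=> w; exact: (iprod_is_cvg (u := fun j => c j w)).
have E m : \int[P]_w (\prod_(j < m) a j w)%:E = \int[P]_w (\prod_(j < m) b j w)%:E.
  have H n : (n <= m)%N -> \int[P]_w (hyb n m w)%:E = \int[P]_w (hyb 0 m w)%:E.
    by elim: n => // n IH nm; rewrite hybS// IH// ltnW.
  have := H m (leqnn m).
  rewrite (_ : hyb m m = fun w => \prod_(j < m) a j w)%R; last first.
    by apply/funext => w; apply: eq_bigr => i _; rewrite ltn_ord.
  by move=> ->; apply: eq_integral => w _; congr EFin; apply: eq_bigr.
have := cvgP a a01 ma; under eq_fun do rewrite E.
by move=> h; rewrite -(cvg_lim _ h)//; apply/cvg_lim => //; exact: cvgP.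
Qed.

End marks.

(** * Unit marks and rescaling *)

Section trivial_independence.
Local Open Scope ereal_scope.
Context {R : realType} d (T : measurableType d) (P : probability T R).

Definition trivial_event (A : set T) := A = set0 \/ A = setT.

Lemma events_of_cst d' (T' : measurableType d') (f : T -> T') (x : T') A :
  (forall w, f w = x) -> events_of f A -> trivial_event A.
Proof.
move=> fx [B mB <-]; have [Bx|Bx] := pselect (B x).
  by right; apply/seteqP; split => // w _; split => //=; rewrite fx.
by left; apply/seteqP; split => // w [_] /=; rewrite fx.
Qed.

Lemma trivial_indep1 (I : eqType) (s : seq I) (E : I -> set T) A :
  (forall i, i \in s -> trivial_event (E i)) ->
  P (A `&` \big[setI/setT]_(i <- s) E i) = P A * \prod_(i <- s) P (E i).
Proof.
elim: s A => [|i s IH] A Es; first by rewrite !big_nil setIT mule1.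
rewrite !big_cons.
have {}IH B := IH B (fun j js => Es j (mem_behead (s := i :: s) js)).
have [->|->] := Es i (mem_head _ _).
  by rewrite set0I setI0 measure0 mul0e mule0.
rewrite setTI IH [X in _ = _ * (X * _)](_ : _ = 1) ?mul1e//.
exact: probability_setT.
Qed.

(** Trivial events factor out of any intersection, and in a list without repetition the exceptional
    index [i0] occurs at most once. It will be the index of the locations, unit marks having only
    trivial events. *)
Lemma trivial_independent (I : eqType) (F : I -> set (set T)) (i0 : I) :
  (forall i A, i != i0 -> F i A -> trivial_event A) ->
  mutually_independent P F.
Proof.
move=> Ftriv s E; elim: s => [|i s IH] us Es.
  by rewrite !big_nil; exact: probability_setT.
move: us => /= /andP[is_ us].
have {}IH := IH us (fun j js => Es j (mem_behead (s := i :: s) js)).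
have [ii0|ii0] := eqVneq i i0.
  rewrite !big_cons trivial_indep1// => j js; apply: (Ftriv j).
    by apply: contraNneq is_ => ji0; rewrite ii0 -ji0.
  by apply: Es; rewrite in_cons js orbT.
rewrite !big_cons; have [->|->] := Ftriv _ _ ii0 (Es i (mem_head _ _)).
  by rewrite set0I measure0 mul0e.
rewrite setTI IH [X in _ = X * _](_ : _ = 1) ?mul1e//.
exact: probability_setT.
Qed.

End trivial_independence.

Section rescaling.
Local Open Scope ereal_scope.
Context {R : realType} (l : nat) d (T : measurableType d) (P : probability T R).
Context d0 (T0 : measurableType d0) (P0 : probability T0 R).
Variables (K Psi : {RV P0 >-> R}) (S : scs l R T) (lambda : R).

Lemma unit_marks (S' : scs l R T) (lambda' : R) :
  (forall j w, tx_power S' j w = 1%R) -> (forall j w, fading S' j w = 1%R) ->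
  (forall j, measurable (present S' j)) ->
  (forall j, measurable_fun setT (location S' j)) ->
  homogeneous_poisson P S' lambda' ->
  homogeneous_scs P S' lambda' (cst 1%R : {RV P >-> R}) (cst 1%R : {RV P >-> R}).
Proof.
move=> tx1 fd1 mp ml hp; split => //.
- move=> j; split => //.
    by rewrite (_ : tx_power S' j = cst 1%R)//; apply/funext => w; rewrite tx1.
  by rewrite (_ : fading S' j = cst 1%R)//; apply/funext => w; rewrite fd1.
- move=> j C mC; congr (P _); apply/seteqP.
  by split => w /=; rewrite /mark tx1 fd1.
- apply: (@trivial_independent _ _ _ P _ _ None) => -[j|] // A _.
  by apply: events_of_cst => w; rewrite /mark tx1 fd1.
Qed.

Hypothesis hS : homogeneous_scs P S lambda K Psi.

Lemma empty_scs : homogeneous_scs P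
  (SCS (fun=> set0) (location S) (fun=> cst 1%R) (fun=> cst 1%R)) 0%R
  (cst 1%R : {RV P >-> R}) (cst 1%R : {RV P >-> R}).
Proof.
have [hm _ _ _] := hS.
have num0 A w : num_bs (SCS (fun=> set0) (location S) (fun=> cst 1%R) (fun=> cst 1%R))
   A w = 0%:E.
  rewrite /num_bs /= (_ : [set j | _] = set0) ?measure0//.
  by apply/seteqP; split => // j [].
apply: unit_marks => [//|//|j|j|]; [exact: measurable0|by have [] := hm j|].
split => [A mA Aoo k|A mA Aoo tA]; last first.
  apply: (@trivial_independent _ _ _ P _ _ 0%N) => i B _.
  by apply: events_of_cst => w; exact: num0.
rewrite mul0r /poisson_prob ltxx diracE.
under eq_set do rewrite num0.
case: k => [|k].
  rewrite mem_set// (_ : [set _ | _] = setT); first exact: probability_setT.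
  by apply/seteqP.
rewrite memNset// (_ : [set _ | _] = set0) ?measure0//.
by apply/seteqP; split => // w /= [] /eqP; rewrite eq_sym pnatr_eq0.
Qed.

(** Dilated points lying in [A] are original points lying in the preimage of [A], whose volume is
    [c^-1 ^+ l] times that of [A]; Poisson counts and their independence carry over. *)
Lemma rescaled_scs (c lambda' : R) : (0 < c)%R -> (lambda * c^-1 ^+ l = lambda')%R ->
  homogeneous_scs P
  (SCS (present S) (fun j w => scale_tuple c (location S j w))
       (fun=> cst 1%R) (fun=> cst 1%R)) lambda'
  (cst 1%R : {RV P >-> R}) (cst 1%R : {RV P >-> R}).
Proof.
move=> c0 cE; have [hm [hpois hind] _ _] := hS.
have mpre (A : set (l.-tuple R)) : measurable A ->
    measurable (@scale_tuple R c l @^-1` A).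
  by move=> mA; rewrite -[X in measurable X]setTI; exact: measurable_scale_tuple.
have volpre (A : set (l.-tuple R)) : measurable A ->
    volume (@scale_tuple R c l @^-1` A) = (c^-1 ^+ l)%:E * volume A.
  by move=> mA; rewrite -!volE vol_scale.
have voloo (A : set (l.-tuple R)) : measurable A -> volume A < +oo ->
    volume (@scale_tuple R c l @^-1` A) < +oo.
  move=> mA Aoo; rewrite volpre//; apply: lte_mul_pinfty => //.
  by rewrite lee_fin exprn_ge0// invr_ge0 ltW.
apply: unit_marks => //= [j|j|].
- by have [] := hm j.
- by have [_ ml _ _] := hm j; apply: (measurableT_comp (@measurable_scale_tuple R c l) ml).
split => [A mA Aoo k|A mA Aoo tA].
- have := hpois _ (mpre A mA) (voloo A mA Aoo) k.
  have Afin : volume A \is a fin_num by rewrite ge0_fin_numE// -volE.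
  by rewrite volpre// fineM// mulrA cE.
- apply: (hind (fun i => @scale_tuple R c l @^-1` A i)) => [i|i|].
  + exact: mpre.
  + exact: voloo.
  + move=> i j _ _ [x [xi xj]]; apply: (tA i j) => //.
    by exists (scale_tuple c x).
Qed.

End rescaling.

(** * Generating functions determine the law *)

Section evaluation_law.
Local Open Scope ereal_scope.
Context {R : realType}.

(** Bundling parameters and sets with their side conditions makes a plain list a finite family of
    tests, on which induction runs without extra hypotheses. *)
Let tB := ({t : R | (0 < t < 1)%R} * {B : set R | measurable B})%type.
Let BC := ({B : set R | measurable B} * {C : set (\bar R) | measurable C})%type.

Section one.
Context d (T : measurableType d) (N : set R -> T -> \bar R).

Definition pgf_weight (s : seq tB) (w : T) : R :=
  \prod_(p <- s) tpow (sval p.1) (N (sval p.2) w).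

Definition event_weight (s : seq BC) (w : T) : R :=
  \prod_(q <- s) \1_(sval q.2) (N (sval q.1) w).

Hypothesis mN : forall B, measurable B -> measurable_fun setT (N B).
Hypothesis Nnat : forall B, nat_valued (N B).

Lemma pgf_weight01 s w : (0 <= pgf_weight s w <= 1)%R.
Proof.
by apply: prod_seq_itv01 => p; apply: tpow_itv01; [exact: (svalP p.1)|exact: Nnat].
Qed.

Lemma event_weight01 s w : (0 <= event_weight s w <= 1)%R.
Proof.
apply: prod_seq_itv01 => p.
by rewrite indicE; case: (_ \in _); rewrite ?lexx ?ler01.
Qed.

Lemma measurable_pgf_weight s : measurable_fun setT (pgf_weight s).
Proof.
apply: measurable_prod_seq => p.
apply: measurable_tpow_comp; [exact: (svalP p.1)| |exact: Nnat].
exact: (mN (svalP p.2)).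
Qed.

Lemma measurable_event_weight s : measurable_fun setT (event_weight s).
Proof.
apply: measurable_prod_seq => q.
exact: (measurableT_comp (measurable_indic (svalP q.2)) (mN (svalP q.1))).
Qed.

Definition cylinder (s : seq BC) : set (set R -> \bar R) :=
  \big[setI/setT]_(q <- s) ((fun m => m (sval q.1)) @^-1` sval q.2).

Lemma preimage_cylinder s : (fun w B => N B w) @^-1` cylinder s =
  \big[setI/setT]_(q <- s) (N (sval q.1) @^-1` sval q.2).
Proof.
rewrite /cylinder; elim: s => [|q s IH]; first by rewrite !big_nil preimage_setT.
by rewrite !big_cons preimage_setI IH.
Qed.

Lemma measurable_preimage_cylinder s :
  measurable ((fun w B => N B w) @^-1` cylinder s).
Proof.
rewrite preimage_cylinder; apply: bigsetI_measurable => q _.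
by rewrite -[X in measurable X]setTI; exact: (mN (svalP q.1) _ (svalP q.2)).
Qed.

Lemma integral_event_weight (P : probability T R) s :
  \int[P]_w (event_weight s w)%:E = P ((fun w B => N B w) @^-1` cylinder s).
Proof.
set A := _ @^-1` _; have mA : measurable A by exact: measurable_preimage_cylinder.
transitivity (\int[P]_w (\1_A w)%:E); last by rewrite integral_indic// setIT.
apply: eq_integral => w _; congr EFin; rewrite /A preimage_cylinder /event_weight.
elim: s {A mA} => [|q s IH]; first by rewrite !big_nil indicT.
by rewrite !big_cons IH indicI.
Qed.

End one.

(** Powers of counts are traded for indicators one count at a time, which gives the
    finite-dimensional laws; cylinders are closed under intersection by concatenation of lists, so
    uniqueness of measures applies. *)
Lemma pgf_evaluation_law d1 (T1 : measurableType d1) (P1 : probability T1 R)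
    d2 (T2 : measurableType d2) (P2 : probability T2 R)
    (N1 : set R -> T1 -> \bar R) (N2 : set R -> T2 -> \bar R) :
  (forall B, measurable B -> measurable_fun setT (N1 B)) ->
  (forall B, nat_valued (N1 B)) ->
  (forall B, measurable B -> measurable_fun setT (N2 B)) ->
  (forall B, nat_valued (N2 B)) ->
  (forall s, \int[P1]_w (pgf_weight N1 s w)%:E = \int[P2]_w (pgf_weight N2 s w)%:E) ->
  forall E, @evaluation_events R E ->
    P1 ((fun w B => N1 B w) @^-1` E) = P2 ((fun w B => N2 B w) @^-1` E).
Proof.
move=> mN1 N1nat mN2 N2nat pgfE.
(* The list [s] stays general in the induction: to convert a power of a new count by
   [pgf_determines], the hypothesis is used both for [s] and for [s] extended by that power. *)
have mixed (s' : seq BC) (s : seq tB) :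
    \int[P1]_w (pgf_weight N1 s w * event_weight N1 s' w)%:E =
    \int[P2]_w (pgf_weight N2 s w * event_weight N2 s' w)%:E.
  elim: s' s => [|q s' IH] s.
    rewrite /event_weight; under eq_integral do rewrite big_nil mulr1.
    by under [in RHS]eq_integral do rewrite big_nil mulr1.
  pose F d (T : measurableType d) (N : set R -> T -> \bar R) w :=
    (pgf_weight N s w * event_weight N s' w)%R.
  have FE d (T : measurableType d) (N : set R -> T -> \bar R) w :
      (pgf_weight N s w * event_weight N (q :: s') w =
       F _ _ N w * \1_(sval q.2) (N (sval q.1) w))%R.
    by rewrite /F /event_weight big_cons -mulrA; congr (_ * _)%R; rewrite mulrC.
  under eq_integral do rewrite FE.
  under [in RHS]eq_integral do rewrite FE.
  have F01 d (T : measurableType d) (N : set R -> T -> \bar R) :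
      (forall B, nat_valued (N B)) -> forall w, (0 <= F _ _ N w <= 1)%R.
    move=> Nnat w; have /andP[a0 a1] := pgf_weight01 Nnat s w.
    have /andP[b0 b1] := event_weight01 N s' w.
    by rewrite /F mulr_ge0//= mulr_ile1.
  have mF d (T : measurableType d) (N : set R -> T -> \bar R) :
      (forall B, measurable B -> measurable_fun setT (N B)) ->
      (forall B, nat_valued (N B)) -> measurable_fun setT (F _ _ N).
    move=> mN Nnat; apply: measurable_funM; first exact: measurable_pgf_weight.
    exact: measurable_event_weight.
  apply: pgf_determines; [exact: mF|exact: F01|exact: mF|exact: F01| | | | | | |].
  - exact: (mN1 _ (svalP q.1)).
  - exact: N1nat.
  - exact: (mN2 _ (svalP q.1)).
  - exact: N2nat.
  - move=> t t01.
    have WE d (T : measurableType d) (N : set R -> T -> \bar R) w :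
       (F _ _ N w * tpow t (N (sval q.1) w) =
        pgf_weight N ((exist _ t t01, q.1) :: s) w * event_weight N s' w)%R.
      by rewrite /F /pgf_weight big_cons /= mulrAC; congr (_ * _)%R; rewrite mulrC.
    under eq_integral do rewrite WE.
    by under [in RHS]eq_integral do rewrite WE.
  - exact: IH.
  - exact: (svalP q.2).
have cylE s : P1 ((fun w B => N1 B w) @^-1` cylinder s) =
              P2 ((fun w B => N2 B w) @^-1` cylinder s).
  rewrite -!integral_event_weight//; have := mixed s [::].
  rewrite /pgf_weight; under eq_integral do rewrite big_nil mul1r.
  by under [in RHS]eq_integral do rewrite big_nil mul1r.
pose G : set (set (set R -> \bar R)) := range cylinder.
pose TG := g_sigma_algebraType G.
have mmap d (T : measurableType d) (N : set R -> T -> \bar R) :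
    (forall B, measurable B -> measurable_fun setT (N B)) ->
    measurable_fun setT (fun w => (fun B => N B w) : TG).
  move=> mN; apply: (@measurability _ _ T TG _ _ G) => //.
  move=> _ [_ [s _ <-] <-]; rewrite setTI.
  exact: measurable_preimage_cylinder.
have evG : @evaluation_events R `<=` <<s G >>.
  apply: smallest_sub; first exact: smallest_sigma_algebra.
  move=> A [B mB [C mC <-]]; rewrite setTI.
  apply: sub_sigma_algebra.
  exists [:: (exist _ B mB, exist _ C mC)] => //.
  by rewrite /cylinder big_seq1.
move=> E /evG GE.
have GGI : setI_closed G.
  move=> _ _ [s _ <-] [s' _ <-]; exists (s ++ s') => //.
  by rewrite /cylinder big_cat.
have GGT : G setT by exists [::] => //; rewrite /cylinder big_nil.
have cover : \bigcup_(k in [set: nat]) (setT : set TG) = setT.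
  by rewrite bigcup_const//; exists 0%N.
pose m1 : {measure set TG -> \bar R} := pushm P1 (mmap _ _ _ mN1).
pose m2 : {measure set TG -> \bar R} := pushm P2 (mmap _ _ _ mN2).
have GTGm : G `<=` (measurable : set (set TG)) by exact: sub_sigma_algebra.
have m12 A : G A -> m1 A = m2 A by move=> [s _ <-]; exact: cylE.
have m1oo (k : nat) : m1 setT < +oo.
  exact: le_lt_trans (@probability_le1 _ _ _ P1 setT measurableT) (ltry 1).
have mE := @g_sigma_algebra_measure_unique _ R TG G GTGm (fun=> setT) (fun=> GGT) cover
  m1 m2 GGI m12 m1oo E GE.
by transitivity (m1 E) => //; rewrite mE.
Qed.

End evaluation_law.

(** * Received powers *)

Section received_laplace.
Local Open Scope ereal_scope.
Context {R : realType} (l : nat) (eps : R).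
Hypotheses (l0 : (0 < l)%N) (eps0 : (0 < eps)%R).

Definition unit_loss (x : l.-tuple R) : R := (euclidean_norm x `^ eps)%R.

Lemma measurable_unit_loss : measurable_fun setT unit_loss.
Proof.
exact: (measurableT_comp (measurable_powR eps) (@measurable_euclidean_norm R l)).
Qed.

(** Inversion is not continuous at 0, so it is rewritten through [powR]; the sign factor reproduces
    the value 0 at 0. *)
Lemma measurable_invr_fun : measurable_fun setT (@GRing.inv R).
Proof.
rewrite (_ : GRing.inv = (fun x : R => Num.sg x * `|x| `^ (-1))%R); last first.
  apply/funext => x; have [->|x0] := eqVneq x 0%R.
    by rewrite sgr0 mul0r invr0.
  rewrite powRN powRr1//; have [x1|x1] := leP 0%R x.
    by rewrite gtr0_sg ?lt_neqAle 1?eq_sym ?x0// mul1r ger0_norm.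
  by rewrite ltr0_sg// ltr0_norm// invrN mulrN mulN1r opprK.
apply: measurable_funM.
  rewrite (_ : Num.sg = (fun x : R => if x == 0 then 0 else if x < 0 then -1 else 1)%R)//.
  apply: measurable_fun_ifT => //; first exact: measurable_fun_eqr.
  by apply: measurable_fun_ifT => //; exact: measurable_fun_ltr.
exact: (measurableT_comp (measurable_powR _) (@normr_measurable R setT)).
Qed.

Variable g : R -> R.
Hypothesis mg : measurable_fun setT g.
Hypothesis g0 : g 0%R = 1%R.
Variable delta : R.
Hypotheses (delta0 : (0 < delta)%R) (g01 : forall r, (delta <= g r <= 1)%R).

Definition unit_rate : \bar R := \int[vol R l]_x (1 - g (unit_loss x)^-1)%:E.

Let g1 r : (0 <= 1 - g r)%R.
Proof. by rewrite subr_ge0; case/andP: (g01 r). Qed.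

Lemma unit_rate_ge0 : 0 <= unit_rate.
Proof. by apply: integral_ge0 => x _; rewrite lee_fin. Qed.

Lemma power_rate (q : R) : (0 <= q)%R ->
  \int[vol R l]_x (1 - g (q / unit_loss x))%:E = (q `^ (l%:R / eps))%:E * unit_rate.
Proof.
(* For power 0 the integrand vanishes by [g 0 = 1]. The right side vanishes because the exponent is
   nonzero, where [0 < l] matters, and because 0 times an infinite rate is 0. *)
rewrite le_eqVlt => /predU1P[<-|q0].
  rewrite powR0 ?mul0e; last first.
    by rewrite mulf_neq0 ?invr_eq0 ?gt_eqF ?ltr0n.
  by apply: integral0_eq => x _; rewrite mul0r g0 subrr.
(* Dilation by [c] multiplies the loss by q^-1, and its Jacobian factor [c^-1 ^+ l] is the wanted
   power of [q]. *)
pose c := (q `^ (- eps^-1))%R.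
have c0 : (0 < c)%R by rewrite powR_gt0.
have lossE x : (q / unit_loss x = (unit_loss (scale_tuple c x))^-1)%R.
  rewrite /unit_loss euclidean_norm_scale ?ltW// powRM ?euclidean_norm_ge0 ?ltW//.
  rewrite invfM -powRrM mulNr mulVf ?gt_eqF// powRN powRr1 ?ltW//.
  by rewrite invrK.
under eq_integral do rewrite lossE.
rewrite (ge0_integral_vol_scale (f := fun x => (1 - g (unit_loss x)^-1)%:E))//.
- congr (_%:E * _); rewrite /c -powRN opprK -powR_mulrn ?powR_ge0// -powRrM.
  by rewrite mulrC.
- apply/measurable_EFinP; apply: measurable_funB => //.
  apply: (measurableT_comp mg).
  exact: (measurableT_comp measurable_invr_fun measurable_unit_loss).
- by move=> x; rewrite lee_fin.
Qed.

Context d (T : measurableType d) (P : probability T R).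
Context d0 (T0 : measurableType d0) (P0 : probability T0 R).
Variables (K Psi : {RV P0 >-> R}) (S : scs l R T) (lambda : R).
Hypotheses (K0 : forall w, (0 <= K w)%R) (Psi0 : forall w, (0 <= Psi w)%R).
Hypothesis lambda0 : (0 <= lambda)%R.
Hypothesis hS : homogeneous_scs P S lambda K Psi.

Lemma received_laplace :
  \int[P]_w (iprod (fun j => if w \in present S j then g (received_power S eps j w)
                              else 1%R))%:E =
  expeR (- (lambda%:E *
    ('E_P0[fun w => ((K w * Psi w) `^ (l%:R / eps))%R] * unit_rate))).
Proof.
have [hm [hpois hind] hlaw hmut] := hS.
have mpres j : measurable (present S j) by have [] := hm j.
have mloc j : measurable_fun setT (location S j) by have [] := hm j.
have mmark j : measurable_fun setT (mark S j).
  by have [_ _ mt mf] := hm j; exact: measurable_fun_pair.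
pose M0 w := (K w, Psi w).
have mM0 : measurable_fun setT M0 by exact: measurable_fun_pair.
pose phi (p : l.-tuple R * (R * R)) := g (p.2.1 * p.2.2 / unit_loss p.1)%R.
have mphi : measurable_fun setT phi.
  apply: (measurableT_comp mg); apply: measurable_funM.
    by apply: measurable_funM; exact: measurableT_comp.
  apply: (measurableT_comp measurable_invr_fun).
  exact: (measurableT_comp measurable_unit_loss).
have phi01 p : (0 <= phi p <= 1)%R.
  have /andP[h1 h2] := g01 (p.2.1 * p.2.2 / unit_loss p.1)%R.
  by rewrite /phi h2 andbT (le_trans (ltW delta0)).
have := mark_mean_iprod mpres mloc mmark mM0 (fun j C => hlaw j C) hmut mphi phi01.
rewrite /= => ->.
(* The bound [delta] survives averaging over the marks and yields the positivity required by
   [poisson_laplace]. *)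
have mean01 x : (0 < mark_mean P0 M0 phi x <= 1)%R.
  have /andP[_ ->] := mark_mean01 P0 mM0 mphi phi01 x; rewrite andbT.
  apply: (lt_le_trans delta0); rewrite -lee_fin (EFin_mark_mean P0 mM0 mphi phi01).
  rewrite [leLHS](_ : _ = \int[P0]_w cst delta%:E w); last first.
    rewrite integral_cst// [X in _ * X](_ : _ = 1) ?mule1//.
    exact: probability_setT.
  apply: ge0_le_integral => //.
  - by move=> w _; rewrite lee_fin ltW.
  - apply/measurable_EFinP; apply: (measurableT_comp mphi).
    exact: measurable_fun_pair.
  - by move=> w _; rewrite lee_fin /phi; case/andP: (g01 (K w * Psi w / unit_loss x)%R).
rewrite (@poisson_laplace R d T P _ _ (vol R l) (present S) (location S) lambda
  mpres mloc lambda0 _ _ (mark_mean P0 M0 phi)); last 4 first.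
- by move=> A mA Aoo k; rewrite volE; apply: hpois => //; rewrite -volE.
- move=> A mA Aoo tA; apply: hind => // i; rewrite -volE; exact: Aoo.
- exact: measurable_mark_mean.
- exact: mean01.
congr (expeR (- (_ * _))).
pose f (p : l.-tuple R * T0) := (1 - phi (p.1, M0 p.2))%:E.
have mf : measurable_fun setT f.
  apply/measurable_EFinP; apply: measurable_funB => //.
  apply: (measurableT_comp mphi); apply: measurable_fun_pair => //.
  exact: measurableT_comp.
have f0 p : 0 <= f p by rewrite lee_fin /phi.
have mfx x : measurable_fun setT (fun z => phi (x, M0 z)).
  by apply: (measurableT_comp mphi); exact: measurable_fun_pair.
transitivity (\int[vol R l]_x \int[P0]_z f (x, z)).
  apply: eq_integral => x _.
  have h : \int[P0]_z f (x, z) + (mark_mean P0 M0 phi x)%:E = 1.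
    rewrite (EFin_mark_mean P0 mM0 mphi phi01) -ge0_integralD//; last 3 first.
    - exact: (measurableT_comp mf (pair1_measurable x)).
    - by move=> z _; rewrite lee_fin; case/andP: (phi01 (x, M0 z)).
    - exact/measurable_EFinP.
    rewrite (eq_integral (cst 1)) => [|z _]; last first.
      by rewrite -EFinD subrK.
    by rewrite integral_cst// mul1e; exact: probability_setT.
  by rewrite EFinB -h addeK.
(* With the marks outermost, [power_rate] applies to each fixed value of K Psi and leaves its
   moment. *)
rewrite fubini_tonelli//.
rewrite unlock -ge0_integralZr//; last 3 first.
- apply/measurable_EFinP; apply: (measurableT_comp (measurable_powR _)).
  exact: measurable_funM.
- by move=> w _; rewrite lee_fin powR_ge0.
- exact: unit_rate_ge0.
by apply: eq_integral => w _; rewrite /f /phi /= power_rate// mulr_ge0.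
Qed.

Definition received_points (B : set R) (w : T) : \bar R := received S eps w B.

Lemma measurable_received_power j : measurable_fun setT (received_power S eps j).
Proof.
have [hm _ _ _] := hS; have [_ ml mt mf] := hm j.
apply: measurable_funM; first exact: measurable_funM.
apply: (measurableT_comp measurable_invr_fun).
exact: (measurableT_comp measurable_unit_loss ml).
Qed.

Lemma measurable_received B : measurable B ->
  measurable_fun setT (received_points B).
Proof.
have [hm _ _ _] := hS => mB.
apply: (measurable_counting (D := fun j => [set w | [/\ present S j w,
  received_power S eps j w != 0%R & B (received_power S eps j w)]])) => j.
rewrite (_ : mkset _ =
  present S j `&` received_power S eps j @^-1` (~` [set 0%R] `&` B)).
  apply: measurableI; first by have [] := hm j.
  rewrite -[X in measurable X]setTI; apply: measurable_received_power => //.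
  by apply: measurableI => //; exact: measurableC.
apply/seteqP; split => w /=.
  by move=> [pw /eqP r0 Bw].
by move=> [pw [/eqP r0 Bw]].
Qed.

Lemma received_nat B : nat_valued (received_points B).
Proof. by move=> w; exact: counting_natP. Qed.

End received_laplace.

(** * Equivalence of systems with equal rates *)

Section equivalence.
Local Open Scope ereal_scope.
Context {R : realType} (l : nat) (eps : R).
Hypotheses (l0 : (0 < l)%N) (eps0 : (0 < eps)%R).

Let tB := ({t : R | (0 < t < 1)%R} * {B : set R | measurable B})%type.

(** Excluding 0 gives the value 1 at 0 and matches the fact that only nonzero powers are counted. *)
Definition pgf_test (s : seq tB) (r : R) : R :=
  \prod_(p <- s) (if r \in ~` [set 0%R] `&` sval p.2 then sval p.1 else 1%R).

Lemma measurable_pgf_test s : measurable_fun setT (pgf_test s).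
Proof.
apply: measurable_prod_seq => p; apply: measurable_fun_ifT => //.
apply: measurable_fun_mem; apply: measurableI; first exact: measurableC.
exact: svalP p.2.
Qed.

Lemma pgf_test0 s : pgf_test s 0%R = 1%R.
Proof. by rewrite /pgf_test big1// => p _; rewrite memNset//= => -[]. Qed.

Lemma pgf_test_bounds s : exists2 delta : R, (0 < delta)%R &
  forall r, (delta <= pgf_test s r <= 1)%R.
Proof.
elim: s => [|p s [delta delta0 IH]].
  by exists 1%R => // r; rewrite /pgf_test big_nil lexx.
have /andP[t0 t1] := svalP p.1.
exists (sval p.1 * delta)%R => [|r]; first exact: mulr_gt0.
rewrite /pgf_test big_cons -/(pgf_test s r).
have /andP[h1 h2] := IH r; have h0 := le_trans (ltW delta0) h1.
case: ifP => _.
  rewrite ler_pM ?(ltW t0) ?(ltW delta0)//=.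
  by apply: mulr_ile1 => //; exact: ltW.
by rewrite mul1r h2 andbT (le_trans _ h1)// ler_piMl ?(ltW delta0)// ltW.
Qed.

Lemma pgf_weight_received d (T : measurableType d) (S : scs l R T) s w :
  pgf_weight (received_points eps S) s w =
  iprod (fun j => if w \in present S j then pgf_test s (received_power S eps j w)
                  else 1%R).
Proof.
rewrite (_ : (fun j => _) = (fun j => \prod_(p <- s)
    (if j \in [set j | [/\ present S j w, received_power S eps j w != 0%R &
       sval p.2 (received_power S eps j w)]] then sval p.1 else 1))%R).
  rewrite iprod_prod => [|p j]; last first.
    case: ifP; rewrite ?ler01 ?lexx// => _.
    by have /andP[/ltW -> /ltW ->] := svalP p.1.
  apply: eq_bigr => p _; rewrite iprod_tpow//.
  by have /andP[/ltW -> ->] := svalP p.1.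
apply/funext => j; have [wj|wj] := boolP (w \in present S j); last first.
  rewrite big1// => p _; rewrite memNset//= => -[/mem_set h _ _].
  by rewrite h in wj.
apply: eq_bigr => p _; congr (if _ then _ else _).
apply/idP/idP => /set_mem.
  move=> [/= /eqP r0 Br]; apply/mem_set; split => //; exact/set_mem.
by move=> [_ /= /eqP r0 Br]; apply/mem_set; split.
Qed.

Lemma equal_rate_equivalent
    d (T : measurableType d) (P : probability T R) (S : scs l R T) (lambda : R)
    d0 (T0 : measurableType d0) (P0 : probability T0 R) (K Psi : {RV P0 >-> R})
    d' (T' : measurableType d') (P' : probability T' R) (S' : scs l R T') (lambda' : R)
    d1 (T1 : measurableType d1) (P1 : probability T1 R) (K' Psi' : {RV P1 >-> R}) :
  (0 <= lambda)%R -> (0 <= lambda')%R ->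
  (forall w, (0 <= K w)%R) -> (forall w, (0 <= Psi w)%R) ->
  (forall w, (0 <= K' w)%R) -> (forall w, (0 <= Psi' w)%R) ->
  homogeneous_scs P S lambda K Psi -> homogeneous_scs P' S' lambda' K' Psi' ->
  lambda%:E * 'E_P0[fun w => ((K w * Psi w) `^ (l%:R / eps))%R] =
  lambda'%:E * 'E_P1[fun w => ((K' w * Psi' w) `^ (l%:R / eps))%R] ->
  scs_equivalent eps P S P' S'.
Proof.
move=> la0 la0' K0 Psi0 K0' Psi0' hS hS' rateE.
apply: (pgf_evaluation_law (N1 := received_points eps S)
                           (N2 := received_points eps S')).
- by move=> B; exact: (measurable_received eps hS).
- exact: received_nat.
- by move=> B; exact: (measurable_received eps hS').
- exact: received_nat.
move=> s; have [delta delta0 bnd] := pgf_test_bounds s.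
under eq_integral do rewrite pgf_weight_received.
under [in RHS]eq_integral do rewrite pgf_weight_received.
have mg := measurable_pgf_test s; have g0 := pgf_test0 s.
rewrite (received_laplace l0 eps0 mg g0 delta0 bnd K0 Psi0 la0 hS).
rewrite (received_laplace l0 eps0 mg g0 delta0 bnd K0' Psi0' la0' hS').
by rewrite !muleA rateE.
Qed.

End equivalence.

(** The first conjunct exhibits a unit-mark system of the required density, so that the second,
    about all such systems, is not vacuous. *)
Theorem corollary3 (R : realType) (l : nat) (eps lambda0 : R)
  (d0 : measure_display) (T0 : measurableType d0) (P0 : probability T0 R)
  (K Psi : {RV P0 >-> R})
  (d : measure_display) (T : measurableType d) (P : probability T R)
  (S : scs l R T) :
  (1 <= l <= 3)%N -> 0 < eps -> 0 < lambda0 ->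
  (forall w, 0 <= K w) -> (forall w, 0 <= Psi w) ->
  homogeneous_scs P S lambda0 K Psi ->
  ('E_P0[fun w => ((K w * Psi w) `^ (l%:R / eps))%R] < +oo)%E ->
  let lambda_bar :=
    lambda0 * fine ('E_P0[fun w => ((K w * Psi w) `^ (l%:R / eps))%R])%E in
  (exists (d' : measure_display) (T' : measurableType d')
      (P' : probability T' R) (S' : scs l R T'),
      homogeneous_scs P' S' lambda_bar
        (cst 1 : {RV P' >-> R}) (cst 1 : {RV P' >-> R}) /\
      scs_equivalent eps P S P' S') /\
  (forall (d' : measure_display) (T' : measurableType d')
      (P' : probability T' R) (S' : scs l R T'),
      homogeneous_scs P' S' lambda_bar
        (cst 1 : {RV P' >-> R}) (cst 1 : {RV P' >-> R}) ->
      scs_equivalent eps P S P' S').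
Proof.
move=> /andP[l0 _] eps0 la0 K0 Psi0 hS Eoo.
set E := ('E_P0[_])%E in Eoo *; move=> lambda_bar.
have E0 : (0 <= E)%E.
  by rewrite /E unlock; apply: integral_ge0 => w _; rewrite lee_fin powR_ge0.
have Efin : E \is a fin_num by rewrite ge0_fin_numE.
have fE0 : 0 <= fine E by rewrite fine_ge0.
have equiv d' (T' : measurableType d') (P' : probability T' R) (S' : scs l R T') :
    homogeneous_scs P' S' lambda_bar
      (cst 1 : {RV P' >-> R}) (cst 1 : {RV P' >-> R}) ->
    scs_equivalent eps P S P' S'.
  move=> hS'; apply: (equal_rate_equivalent l0 eps0 _ _ K0 Psi0 _ _ hS hS').
  - exact: ltW.
  - by rewrite mulr_ge0// ltW.
  - by move=> w; exact: ler01.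
  - by move=> w; exact: ler01.
  (* Unit marks have moment 1, so the rate of [S'] is its density [lambda_bar]. *)
  rewrite -/E [X in (_ = _ * X)%E](_ : _ = 1%E); last first.
    rewrite unlock (eq_integral (cst 1%E)) => [|w _]; last first.
      by rewrite /= mulr1 powR1.
    by rewrite integral_cst// mul1e; exact: probability_setT.
  by rewrite mule1 /lambda_bar EFinM fineK.
split; last exact: equiv.
suff [S' hS'] : exists S' : scs l R T, homogeneous_scs P S' lambda_bar
    (cst 1 : {RV P >-> R}) (cst 1 : {RV P >-> R}).
  by exists d, T, P, S'; split; [exact: hS'|exact: (equiv _ _ _ _ hS')].
move: fE0; rewrite le_eqVlt => /predU1P[fE|fE0].
  by eexists; rewrite /lambda_bar -fE mulr0; exact: (empty_scs hS).
(* A dilation by [c] multiplies the density by [c^-1 ^+ l]; the [l]-th root makes this factor equal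
   to the moment. *)
eexists; apply: (rescaled_scs hS (c := (fine E `^ l%:R^-1)^-1)).
  by rewrite invr_gt0 powR_gt0.
rewrite invrK -powR_mulrn ?powR_ge0// -powRrM mulVf ?pnatr_eq0 -?lt0n//.
by rewrite powRr1// ltW.
Qed.
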